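(* $\pi(x) \sim \operatorname{Li}(x)$ as $x\to\infty$; that is, $\displaystyle\lim_{x\to\infty} \frac{\pi(x)}{\operatorname{Li}(x)} = 1$, where $\displaystyle\operatorname{Li}(x) = \int_2^x \frac{dt}{\log t}$.
   Context: For real $x$, $\pi(x)$ denotes the number of prime numbers $p$ with $p \leq x$. $\log$ is the natural logarithm. For real-valued functions $f,g$ defined and nonzero for all sufficiently large $x$, $f(x)\sim g(x)$ means $\lim_{x\to\infty} f(x)/g(x) = 1$. The function $\operatorname{Li}$ is called the logarithmic integral. *)

(* Defs.v *)
From Stdlib Require Import Reals Lra Lia ZArith.
From mathcomp Require Import ssreflect ssrfun ssrbool eqtype ssrnat seq prime.
From Coquelicot Require Import Coquelicot.

Open Scope R_scope.

(* Candidates are the naturals p < up x; as up x is the least integer > x,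
   these are exactly the naturals p <= x (none if x < 0). *)
Definition primes_le (x : R) : seq nat :=
  [seq p <- seq.iota 0 (Z.to_nat (up x)) | prime.prime p].

Definition prime_pi (x : R) : nat := size (primes_le x).

Lemma mem_primes_le (x : R) (p : nat) :
  p \in primes_le x <-> prime.prime p /\ INR p <= x.
Proof.
rewrite mem_filter mem_iota /= add0n.
have [h1 h2] := archimed x.
have E : (p < Z.to_nat (up x))%N <-> INR p <= x.
  rewrite INR_IZR_INZ; split.
  - move/ltP => H.
    have /IZR_le : (Z.of_nat p <= up x - 1)%Z by lia.
    rewrite minus_IZR; lra.
  - move=> H; apply/ltP.
    have : (Z.of_nat p < up x)%Z by apply: lt_IZR; lra.
    lia.
by split=> [/andP[-> /E]|[-> /E ->]].
Qed.

Lemma uniq_primes_le (x : R) : uniq (primes_le x).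
Proof. by rewrite filter_uniq // iota_uniq. Qed.

Definition Li (x : R) : R := RInt (fun t => / ln t) 2 x.

Lemma continuous_inv_ln (t : R) : 1 < t -> continuous (fun t => / ln t) t.
Proof.
move=> ht; apply: ex_derive_continuous; auto_derive.
have := ln_increasing 1 t; rewrite ln_1; split; [lra|split=> //; lra].
Qed.

Lemma ex_RInt_Li (x : R) : 1 < x -> ex_RInt (fun t => / ln t) 2 x.
Proof.
move=> hx; apply: ex_RInt_continuous => t [ht _].
apply: continuous_inv_ln; move: ht; rewrite /Rmin; case: Rle_dec; lra.
Qed.

Lemma Li_gt0 (x : R) : 2 < x -> 0 < Li x.
Proof.
move=> hx; apply: RInt_gt_0 => // t ht; last by apply: continuous_inv_ln; lra.
apply: Rinv_0_lt_compat; rewrite -ln_1; apply: ln_increasing; lra.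
Qed.

(* Meant for f and g that are nonzero near +oo. *)
Definition asymp_equiv (f g : R -> R) : Prop :=
  is_lim (fun x => f x / g x) p_infty 1.

(* Main.v *)
Require Import Defs.
From Stdlib Require Import Reals Lra Lia ZArith.
From HB Require Import structures.
From mathcomp Require Import zify_ssreflect.
From mathcomp Require Import ssreflect ssrfun ssrbool eqtype ssrnat seq div.
From mathcomp Require Import choice fintype path prime bigop.
From Coquelicot Require Import Coquelicot.

Open Scope R_scope.

(** This is the elementary proof of Selberg and Erdos, written for sums over
    naturals: Selberg's recursion from [N] to [N / n] goes through [N %/ n].

    Let [psi N] be the sum of von Mangoldt's function up to [N] and
    [err N = psi N - N]. The heart of the matter is that [err N / N] tends to
    [0] ([err_little_o]); the passage from there to [prime_pi] and [Li] is a
    comparison of both with [x / ln x] ([is_lim_prime_pi], [is_lim_Li]).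

    Moebius inversion weighted by a logarithm gives Selberg's formula: the sum
    of [err N * ln N] and of all [mangoldt n * err (N %/ n)] is [O(N)]
    ([selberg_err]). It says that [err N] is, up to the sign, an average of the
    values [err (N %/ n)], with weights that are not known individually. Two
    things follow from it. Applied twice, it gives an inequality in which the
    unknown weights have been replaced by the smooth weight [2 * ln n]
    ([err_ln_sqr_le]): [|err N| * ln N ^ 2] is at most the sum of
    [2 * ln n * |err (N %/ n)|], up to [O(N ln N)]. And as von Mangoldt's
    function and its convolution square are nonnegative, it bounds the number of
    primes in a short interval ([psi_short]).

    Since [ln n / n] adds up to [ln N ^ 2 / 2], the inequality alone turns a
    bound [|err k| <= b * k] into the same bound: something has to be gained.
    By Mertens' theorem the sums of [err k / (k * (k + 1))] are bounded
    ([rsum_err_interval_bounded]), so that [err] cannot keep one sign at size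
    [d * k] over a long range; as it changes sign only where it is small, every
    range from a large [a] to [B * a] contains a point where [|err|] is at most
    [d * k], and by [psi_short] it stays at most [2 * d * k] on an interval of
    fixed relative length around that point ([err_small_interval]). On a
    logarithmic scale these intervals fill a positive proportion of everything,
    so the inequality yields [b - c] instead of [b], with [c] depending only on
    a lower bound of [b] ([err_improve]). The infimum of the admissible [b] is
    therefore [0]. *)

(** * Finite sums of real numbers *)

HB.instance Definition _ := Monoid.isComLaw.Build R 0 Rplus
  (fun x y z => esym (Rplus_assoc x y z)) Rplus_comm Rplus_0_l.
HB.instance Definition _ := Monoid.isMulLaw.Build R 0 Rmult
  Rmult_0_l Rmult_0_r.
HB.instance Definition _ := Monoid.isAddLaw.Build R Rmult Rplus
  Rmult_plus_distr_r Rmult_plus_distr_l.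

Local Notation "\sum_ ( m <= i < n ) F" :=
  (\big[Rplus/0%R]_(m <= i < n) F%R) : R_scope.
Local Notation "\sum_ ( m <= i < n | P ) F" :=
  (\big[Rplus/0%R]_(m <= i < n | P%B) F%R) : R_scope.

Lemma INR_ge1 n : (0 < n)%N -> 1 <= INR n.
Proof. by move=> n0; rewrite -[1]/(INR 1); apply: le_INR; lia. Qed.

Lemma INR_addn m n : INR (m + n)%N = INR m + INR n.
Proof. exact: plus_INR. Qed.

Lemma INR_muln m n : INR (m * n)%N = INR m * INR n.
Proof. exact: mult_INR. Qed.

Lemma INR_leq m n : (m <= n)%N -> INR m <= INR n.
Proof. by move=> h; apply: le_INR; lia. Qed.

Lemma INR_divn N d : (0 < d)%N ->
  INR (N %/ d) <= INR N / INR d < INR (N %/ d) + 1.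
Proof.
move=> d0; have d1 := INR_ge1 _ d0.
have /(f_equal INR) := divn_eq N d; rewrite INR_addn INR_muln => E.
have : INR (N %% d) + 1 <= INR d.
  by rewrite -S_INR; apply: INR_leq; rewrite ltn_mod.
have := pos_INR (N %% d) => h0 h1.
have X : INR N / INR d * INR d = INR N by field; lra.
split; nra.
Qed.

Lemma divn_gt0_le N d : (0 < d <= N)%N -> (0 < N %/ d)%N.
Proof. by move=> /andP[d0 dN]; rewrite divn_gt0. Qed.

Lemma rsum_recr m n (f : nat -> R) : (m <= n)%N ->
  \sum_(m <= i < n.+1) f i = \sum_(m <= i < n) f i + f n.
Proof. exact: big_nat_recr. Qed.

Lemma rsum_mkcond m n (P : pred nat) (f : nat -> R) :
  \sum_(m <= i < n | P i) f i = \sum_(m <= i < n) (if P i then f i else 0).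
Proof. exact: big_mkcond. Qed.

Lemma ler_rsum m n (f g : nat -> R) :
  (forall i, (m <= i < n)%N -> f i <= g i) ->
  \sum_(m <= i < n) f i <= \sum_(m <= i < n) g i.
Proof.
move=> h; rewrite big_nat [X in _ <= X]big_nat.
by elim/big_rec2: _ => [|i x y /h]; lra.
Qed.

Lemma rsum_ge0 m n (f : nat -> R) :
  (forall i, (m <= i < n)%N -> 0 <= f i) -> 0 <= \sum_(m <= i < n) f i.
Proof. by move=> h; rewrite big_nat; elim/big_rec: _ => [|i x /h]; lra. Qed.

Lemma rsum_abs m n (f : nat -> R) :
  Rabs (\sum_(m <= i < n) f i) <= \sum_(m <= i < n) Rabs (f i).
Proof.
elim/big_rec2: _ => [|i x y _ h]; first by rewrite Rabs_R0; lra.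
by have := Rabs_triang (f i) y; lra.
Qed.

Lemma rsumD m n (f g : nat -> R) :
  \sum_(m <= i < n) (f i + g i) =
  \sum_(m <= i < n) f i + \sum_(m <= i < n) g i.
Proof. exact: big_split. Qed.

Lemma rsumZ m n c (f : nat -> R) :
  \sum_(m <= i < n) (c * f i) = c * \sum_(m <= i < n) f i.
Proof. by rewrite big_distrr. Qed.

Lemma rsumB m n (f g : nat -> R) :
  \sum_(m <= i < n) (f i - g i) =
  \sum_(m <= i < n) f i - \sum_(m <= i < n) g i.
Proof.
have -> : \sum_(m <= i < n) (f i - g i) = \sum_(m <= i < n) (f i + -1 * g i).
  by apply: eq_bigr => i _; ring.
by rewrite rsumD rsumZ; ring.
Qed.

Lemma rsum_const_ge m n c : (m <= n)%N ->
  \sum_(m <= i < n) c = (INR n - INR m) * c.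
Proof.
elim: n => [|n IH]; first by case: m => // _; rewrite big_geq //=; ring.
rewrite leq_eqVlt => /orP[/eqP ->|mn]; first by rewrite big_geq //; ring.
by rewrite rsum_recr // IH // S_INR; ring.
Qed.

Lemma rsum_const n c : \sum_(1 <= i < n.+1) c = INR n * c.
Proof. by rewrite rsum_const_ge // S_INR /=; ring. Qed.

Lemma rsum_cat m n p (f : nat -> R) : (m <= n)%N -> (n <= p)%N ->
  \sum_(m <= i < p) f i = \sum_(m <= i < n) f i + \sum_(n <= i < p) f i.
Proof. exact: big_cat_nat. Qed.

Lemma rsum_widen m n n' (f : nat -> R) : (m <= n <= n')%N ->
  (forall i, (n <= i < n')%N -> f i = 0) ->
  \sum_(m <= i < n') f i = \sum_(m <= i < n) f i.
Proof.
move=> /andP[mn nn'] h; rewrite (big_cat_nat mn nn') /= [X in _ + X = _]big_nat.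
by rewrite [X in _ + X = _]big1 ?Rplus_0_r.
Qed.

Lemma rsum_telescope m n (f : nat -> R) : (m <= n)%N ->
  \sum_(m <= i < n) (f i.+1 - f i) = f n - f m.
Proof.
elim: n => [|n IH] mn; first by case: m mn => // _; rewrite big_geq //; ring.
move: mn; rewrite leq_eqVlt => /orP[/eqP ->|mn]; first by rewrite big_geq //; ring.
by rewrite rsum_recr // IH //; ring.
Qed.

(** Summation by parts, stated with the boundary term at [N.+1] so that a [b]
    vanishing beyond [N] leaves no boundary term at all. *)
Lemma rsum_abel N (a b : nat -> R) :
  \sum_(1 <= n < N.+1) (a n * b n) =
  \sum_(1 <= n < N.+1) ((\sum_(1 <= k < n.+1) a k) * (b n - b n.+1))
  + (\sum_(1 <= k < N.+1) a k) * b N.+1.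
Proof.
elim: N => [|N IH]; first by rewrite !big_geq //; ring.
rewrite rsum_recr // IH [in RHS]rsum_recr // !(rsum_recr 1 N.+1 a) //; ring.
Qed.

(** Induction on [N]: both sides gain a term exactly when [d] divides [N.+1],
    which is when [N %/ d] increases. *)
Lemma rsum_multiples N d (g : nat -> R) : (0 < d)%N ->
  \sum_(1 <= k < N.+1 | d %| k) g k = \sum_(1 <= m < (N %/ d).+1) g (d * m)%N.
Proof.
move=> d0; elim: N => [|N IH]; first by rewrite div0n !big_geq.
rewrite rsum_mkcond rsum_recr // -rsum_mkcond IH divnS //.
case: ifP => h; last by rewrite add0n; ring.
rewrite add1n [in RHS]rsum_recr //; congr (_ + g _).
rewrite -[(N %/ d).+1]/(1 + N %/ d)%N.
have := divnS N d0; rewrite h /= => <-.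
by rewrite mulnC divnK.
Qed.

(** Dirichlet convolution when [f d e] is a product [u d * v e]; the two-place
    [f] also covers the sums over divisors whose summand is not a product. *)
Definition dsum (f : nat -> nat -> R) (k : nat) :=
  \sum_(1 <= d < k.+1 | d %| k) f d (k %/ d)%N.

(** Both sides run over the pairs [(d, m)] with [d * m <= N]: on the left they
    are grouped by their product. *)
Lemma rsum_dsum N (f : nat -> nat -> R) :
  \sum_(1 <= k < N.+1) dsum f k =
  \sum_(1 <= d < N.+1) \sum_(1 <= m < (N %/ d).+1) f d m.
Proof.
have -> : \sum_(1 <= k < N.+1) dsum f k = \sum_(1 <= k < N.+1)
    \sum_(1 <= d < N.+1) (if d %| k then f d (k %/ d)%N else 0).
  rewrite big_nat [RHS]big_nat; apply: eq_bigr => k /andP[k1 kN].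
  rewrite /dsum rsum_mkcond; symmetry; apply: rsum_widen; first by lia.
  move=> d dk; case: ifP => // /dvdn_leq; lia.
rewrite exchange_big_nat /= big_nat [RHS]big_nat.
apply: eq_bigr => d /andP[d1 _].
transitivity (\sum_(1 <= k < N.+1 | d %| k) f d (k %/ d)%N).
  exact: (esym (rsum_mkcond _ _ _ (fun k => f d (k %/ d)%N))).
rewrite rsum_multiples //.
by apply: eq_bigr => m _; rewrite mulKn.
Qed.

Lemma eq_dsum f g k : (0 < k)%N ->
  (forall d e, (0 < d)%N -> (0 < e)%N -> k = (d * e)%N -> f d e = g d e) ->
  dsum f k = dsum g k.
Proof.
move=> k0 h; rewrite /dsum big_nat_cond [RHS]big_nat_cond.
apply: eq_bigr => d /andP[/andP[d0 dk] dvd]; apply: h => //; last by rewrite mulnC divnK.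
by apply: divn_gt0_le; rewrite d0.
Qed.

Lemma rsum_pairs N (f : nat -> nat -> R) :
  \sum_(1 <= d < N.+1) \sum_(1 <= m < (N %/ d).+1) f d m =
  \sum_(1 <= d < N.+1) \sum_(1 <= m < N.+1) (if (d * m <= N)%N then f d m else 0).
Proof.
rewrite big_nat [RHS]big_nat; apply: eq_bigr => d /andP[d0 dN].
transitivity (\sum_(1 <= m < (N %/ d).+1) (if (d * m <= N)%N then f d m else 0)).
  rewrite big_nat [RHS]big_nat; apply: eq_bigr => m; rewrite ltnS leq_divRL //.
  by rewrite mulnC => /andP[_ ->].
symmetry; apply: rsum_widen; first by rewrite !ltnS leq_div.
by move=> m /andP[h _]; rewrite mulnC -leq_divRL // leqNgt h.
Qed.

Lemma rsum_pairsC N (f : nat -> nat -> R) :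
  \sum_(1 <= d < N.+1) \sum_(1 <= m < (N %/ d).+1) f d m =
  \sum_(1 <= m < N.+1) \sum_(1 <= d < (N %/ m).+1) f d m.
Proof.
rewrite rsum_pairs (rsum_pairs N (fun m d => f d m)) exchange_big_nat /=.
by apply: eq_bigr => m _; apply: eq_bigr => d _; rewrite mulnC.
Qed.

(** * Arithmetic functions *)

Lemma rsum_delta N j c : (0 < j <= N)%N ->
  \sum_(1 <= i < N.+1) (if i == j then c else 0) = c.
Proof.
elim: N => [|N IH] jN; first lia.
rewrite rsum_recr //; have [j0 [->|jN']] : (0 < j)%N /\ (j = N.+1 \/ j <= N)%N.
    by split; lia.
  rewrite eqxx big_nat big1 ?Rplus_0_l // => i /andP[_ h].
  by case: eqP => // E; lia.
rewrite IH; last lia.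
case: eqP => [E|_]; [lia|ring].
Qed.

Lemma dsum1 f : dsum f 1 = f 1%N 1%N.
Proof.
by rewrite /dsum rsum_mkcond rsum_recr // big_geq //= divn1 Rplus_0_l.
Qed.

Lemma dsum_widen f k N : (0 < k <= N)%N ->
  dsum f k = \sum_(1 <= d < N.+1 | d %| k) f d (k %/ d)%N.
Proof.
move=> /andP[k0 kN]; rewrite /dsum rsum_mkcond [RHS]rsum_mkcond; symmetry.
apply: rsum_widen; first lia.
by move=> d dk; case: ifP => // /dvdn_leq; lia.
Qed.

Lemma dsum_dsum k (h : nat -> nat -> R) : (0 < k)%N ->
  dsum (fun d e => dsum (fun a _ => h d a) e) k =
  \sum_(1 <= d < k.+1) \sum_(1 <= a < k.+1) (if (d * a)%N %| k then h d a else 0).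
Proof.
move=> k0; rewrite /dsum rsum_mkcond big_nat [RHS]big_nat.
apply: eq_bigr => d /andP[d0 dk]; case: ifP => dvd; last first.
  rewrite big1 // => a _; case: ifP => // h1.
  by rewrite (dvdn_trans (dvdn_mulr a (dvdnn d)) h1) in dvd.
rewrite -/(dsum (fun a _ => h d a) (k %/ d)%N) (@dsum_widen _ _ k); last first.
  by rewrite divn_gt0_le ?d0 //= leq_div.
by rewrite rsum_mkcond; apply: eq_bigr => a _; rewrite dvdn_divRL // mulnC.
Qed.

(** Associativity of Dirichlet convolution: both sides run over the pairs
    [(d, a)] with [d * a] dividing [k]. *)
Lemma dsum_exchange k (h : nat -> nat -> R) : (0 < k)%N ->
  dsum (fun d e => dsum (fun a _ => h d a) e) k =
  dsum (fun a e => dsum (fun d _ => h d a) e) k.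
Proof.
move=> k0; rewrite !dsum_dsum // exchange_big_nat /=.
by apply: eq_bigr => a _; apply: eq_bigr => d _; rewrite mulnC.
Qed.

(** Von Mangoldt's function; a number with a single prime factor is a power of
    that prime. *)
Definition mangoldt (n : nat) : R :=
  if primes n is [:: p] then ln (INR p) else 0.

Lemma ln_ge0 x : 1 <= x -> 0 <= ln x.
Proof. by move=> x1; rewrite -ln_1; apply: ln_le; lra. Qed.

Lemma ln_INR_ge0 n : (0 < n)%N -> 0 <= ln (INR n).
Proof. by move=> /INR_ge1 /ln_ge0. Qed.

Lemma primes1_in n p : primes n = [:: p] -> [/\ prime p, (0 < n)%N & p %| n].
Proof.
move=> E; have : p \in primes n by rewrite E inE.
by rewrite mem_primes => /and3P[].
Qed.

Lemma mangoldt_ge0 n : 0 <= mangoldt n.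
Proof.
rewrite /mangoldt; case E: (primes n) => [|p [|]]; try lra.
by have [/prime_gt0 p0 _ _] := primes1_in _ _ E; apply: ln_INR_ge0.
Qed.

Lemma mangoldt_le_ln n : (0 < n)%N -> mangoldt n <= ln (INR n).
Proof.
move=> n0; have := ln_INR_ge0 _ n0.
rewrite /mangoldt; case E: (primes n) => [|p [|]] //; try lra.
have [/prime_gt0 p0 _ dvd] := primes1_in _ _ E => _.
apply: ln_le; first by have := INR_ge1 _ p0; lra.
by apply: INR_leq; apply: dvdn_leq.
Qed.

Lemma mangoldt1 : mangoldt 1 = 0.
Proof. by []. Qed.

Lemma mangoldt_pX p k : prime p -> mangoldt (p ^ k.+1) = ln (INR p).
Proof. by move=> pp; rewrite /mangoldt primesX // primes_prime. Qed.

Lemma mangoldt_neq0 n : mangoldt n <> 0 ->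
  exists p k, [/\ prime p, (0 < k)%N & n = (p ^ k)%N].
Proof.
rewrite /mangoldt; case E: (primes n) => [|p [|]] // _.
have [pp n0 dvd] := primes1_in _ _ E.
exists p, (logn p n); split=> //; first by rewrite logn_gt0 mem_primes pp n0.
by rewrite {1}(prod_prime_decomp n0) prime_decompE E big_map big_seq1.
Qed.

Lemma ln_prime_gt0 p : prime p -> 0 < ln (INR p).
Proof.
move=> /prime_gt1 /INR_leq; rewrite -[INR 2]/2 => p2.
by rewrite -ln_1; apply: ln_increasing; lra.
Qed.

(** Among the divisors of [p * m] that do not divide [m], the only prime power
    is the highest power of [p]. *)
Lemma dsum_mangoldt_prime_mul p m : prime p -> (0 < m)%N ->
  dsum (fun d _ => mangoldt d) (p * m) = dsum (fun d _ => mangoldt d) m + ln (INR p).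
Proof.
move=> pp m0; have p0 := prime_gt0 pp.
have pm0 : (0 < p * m)%N by rewrite muln_gt0 p0.
have mpm : (m <= p * m)%N by rewrite leq_pmull.
have lgp : logn p (p * m) = (logn p m).+1 by rewrite lognM // logn_prime // eqxx.
have dvd_top : (p ^ (logn p m).+1 %| p * m)%N by rewrite pfactor_dvdn // lgp.
rewrite (@dsum_widen _ m (p * m)) ?m0 // /dsum rsum_mkcond
  [X in _ = X + _]rsum_mkcond.
rewrite -(@rsum_delta (p * m) (p ^ (logn p m).+1) (ln (INR p))); last first.
  by rewrite expn_gt0 p0 dvdn_leq.
rewrite -rsumD; apply: eq_bigr => d _.
case: (d =P (p ^ (logn p m).+1)%N) => [->|ne].
  by rewrite dvd_top pfactor_dvdn // ltnn mangoldt_pX //; ring.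
case: (Req_dec (mangoldt d) 0) => [->|/mangoldt_neq0 [q [j [qp j0 dE]]]].
  by case: ifP; case: ifP => _ _; ring.
have -> : (d %| p * m) = (d %| m); last by ring.
rewrite dE !pfactor_dvdn // lognM // logn_prime //.
case: eqP => [qpE|_] //; subst q.
have : j <> (logn p m).+1 by move=> E; rewrite E in dE.
lia.
Qed.

(** Removing the prime factors of [n] one at a time. *)
Lemma dsum_mangoldt n : (0 < n)%N -> dsum (fun d _ => mangoldt d) n = ln (INR n).
Proof.
elim/ltn_ind: n => n IH n0.
have [n1|n1] := leqP n 1.
  have -> : n = 1%N by lia.
  by rewrite dsum1 mangoldt1 /= ln_1.
have pp := pdiv_prime n1; have dvd := pdiv_dvd n.
have q0 : (0 < n %/ pdiv n)%N by rewrite divn_gt0_le // pdiv_gt0 dvdn_leq.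
have nE : n = (pdiv n * (n %/ pdiv n))%N by rewrite mulnC divnK.
rewrite {1}nE dsum_mangoldt_prime_mul // IH ?ltn_Pdiv ?prime_gt1 //.
have := INR_ge1 _ q0; have := INR_ge1 _ (prime_gt0 pp) => h1 h2.
by rewrite [in RHS]nE INR_muln ln_mult; lra.
Qed.

Definition moebius (n : nat) : R :=
  if all (fun p => logn p n == 1%N) (primes n) then (-1) ^ size (primes n)
  else 0.

Lemma moebius_abs_le1 n : Rabs (moebius n) <= 1.
Proof.
rewrite /moebius; case: ifP => _; last by rewrite Rabs_R0; lra.
by rewrite pow_1_abs; lra.
Qed.

Lemma moebius_primeM p e : prime p -> (0 < e)%N ->
  moebius (p * e) = if p %| e then 0 else - moebius e.
Proof.
move=> pp e0; have p0 := prime_gt0 pp.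
have pe0 : (0 < p * e)%N by rewrite muln_gt0 p0.
have lg q : prime q -> logn q (p * e) = ((q == p) + logn q e)%N.
  by move=> qp; rewrite lognM // logn_prime.
case: ifP => dvd.
  rewrite /moebius; case: allP => // /(_ p).
  rewrite mem_primes pp pe0 dvdn_mulr // => /(_ isT).
  rewrite lg // eqxx; have : (0 < logn p e)%N by rewrite logn_gt0 mem_primes pp e0.
  by case: logn.
have pe : p \notin primes e by rewrite mem_primes pp e0 dvd.
have perm : perm_eq (primes (p * e)) (p :: primes e).
  apply: uniq_perm; rewrite ?primes_uniq //= ?pe ?primes_uniq //.
  by move=> q; rewrite primesM // inE primes_prime // inE.
rewrite /moebius (perm_size perm) (perm_all _ perm) /= lg // eqxx.
have -> : logn p e = 0%N by apply/eqP; rewrite lognE pp e0 dvd.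
have -> : all (fun q => logn q (p * e) == 1%N) (primes e) =
          all (fun q => logn q e == 1%N) (primes e).
  apply: eq_in_all => q qe; rewrite lg; last by move: qe; rewrite mem_primes => /andP[].
  by case: (q =P p) => // qp; rewrite -qp qe in pe.
by rewrite /=; case: ifP => _; ring.
Qed.

(** With [p] a prime factor of [n], the squarefree divisors of [n] come in pairs
    [d], [p * d] with opposite signs. *)
Lemma dsum_moebius n : (0 < n)%N ->
  dsum (fun d _ => moebius d) n = if n == 1%N then 1 else 0.
Proof.
move=> n0; case: eqP => [->|n1]; first by rewrite dsum1.
have {}n1 : (1 < n)%N by lia.
have [p pp dvd] : exists2 p, prime p & p %| n.
  by exists (pdiv n); [apply: pdiv_prime | apply: pdiv_dvd].
have p0 := prime_gt0 pp.
pose g d := if d %| n then moebius d else 0.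
have -> : dsum (fun d _ => moebius d) n = \sum_(1 <= d < n.+1 | p %| d) g d +
    \sum_(1 <= d < n.+1) (if p %| d then 0 else g d).
  rewrite /dsum rsum_mkcond [X in _ = X + _]rsum_mkcond -rsumD.
  apply: eq_bigr => d _; rewrite /g.
  by case: ifP; case: ifP => _ _; ring.
rewrite rsum_multiples // -(@rsum_widen _ _ n.+1) ?ltnS ?leq_div //; last first.
  move=> e /andP[en _]; rewrite /g; case: ifP => // /(dvdn_leq n0).
  by rewrite mulnC -leq_divRL //; lia.
rewrite -rsumD big_nat big1 // => e /andP[e0 _]; rewrite /g moebius_primeM //.
case: (boolP (p %| e)) => pe; first by case: ifP => _; ring.
rewrite Gauss_dvd ?dvd /=; last by rewrite prime_coprime.
by case: ifP => _; ring.
Qed.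

Lemma dsumZ c f k : dsum (fun d e => c * f d e) k = c * dsum f k.
Proof. by rewrite /dsum big_distrr. Qed.

Lemma dsumD f g k : dsum (fun d e => f d e + g d e) k = dsum f k + dsum g k.
Proof. exact: big_split. Qed.

(** Moebius inversion of [dsum_mangoldt]. *)
Lemma dsum_moebius_ln k : (0 < k)%N ->
  dsum (fun d e => moebius d * ln (INR e)) k = mangoldt k.
Proof.
move=> k0.
transitivity (dsum (fun d e => dsum (fun a _ => moebius d * mangoldt a) e) k).
  by apply: eq_dsum => // d e _ e0 _; rewrite dsumZ dsum_mangoldt.
rewrite dsum_exchange //.
transitivity (\sum_(1 <= a < k.+1) (if a == k then mangoldt k else 0)).
  rewrite /dsum rsum_mkcond big_nat [RHS]big_nat.
  apply: eq_bigr => a /andP[a0 ak].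
  case: ifP => ak'; last by case: eqP ak' => // ->; rewrite dvdnn.
  rewrite -/(dsum (fun d _ => moebius d * mangoldt a) (k %/ a)%N).
  have -> : dsum (fun d _ => moebius d * mangoldt a) (k %/ a) =
            mangoldt a * dsum (fun d _ => moebius d) (k %/ a).
    by rewrite -dsumZ; apply: eq_bigr => d _; ring.
  rewrite dsum_moebius; last by rewrite divn_gt0_le ?a0.
  have -> : (k %/ a == 1)%N = (a == k).
    apply/eqP/eqP => [E|->]; last by rewrite divnn k0.
    by rewrite -(divnK ak') E mul1n.
  by case: eqP => [->|_]; ring.
by rewrite rsum_delta // k0 leqnn.
Qed.

(** * Chebyshev and Mertens *)

Lemma ln_le_sub1 x : 0 < x -> ln x <= x - 1.
Proof. by move=> x0; have := exp_ineq1_le (ln x); rewrite exp_ln //; lra. Qed.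

Lemma ln_le_id x : 0 < x -> ln x <= x.
Proof. by move=> /ln_le_sub1; lra. Qed.

Lemma ln_ratio_le x y : 0 < x -> 0 < y -> ln y - ln x <= (y - x) / x.
Proof.
move=> x0 y0; rewrite -ln_div //.
have := ln_le_sub1 (y / x) (Rdiv_lt_0_compat _ _ y0 x0).
by have -> : y / x - 1 = (y - x) / x by field; lra.
Qed.

Lemma ln_incr_bounds n : (0 < n)%N ->
  / INR n.+1 <= ln (INR n.+1) - ln (INR n) <= / INR n.
Proof.
move=> /INR_ge1 n1; rewrite S_INR.
have := ln_ratio_le (INR n) (INR n + 1); have := ln_ratio_le (INR n + 1) (INR n).
have -> : (INR n - (INR n + 1)) / (INR n + 1) = - / (INR n + 1) by field; lra.
have -> : (INR n + 1 - INR n) / (INR n) = / INR n by field; lra.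
lra.
Qed.

Definition psi (N : nat) : R := \sum_(1 <= n < N.+1) mangoldt n.
Definition sum_ln (N : nat) : R := \sum_(1 <= n < N.+1) ln (INR n).
Definition harm (N : nat) : R := \sum_(1 <= n < N.+1) / INR n.

Lemma psiS n : psi n.+1 = psi n + mangoldt n.+1.
Proof. exact: rsum_recr. Qed.
Lemma sum_lnS n : sum_ln n.+1 = sum_ln n + ln (INR n.+1).
Proof. exact: rsum_recr. Qed.
Lemma harmS n : harm n.+1 = harm n + / INR n.+1.
Proof. exact: rsum_recr. Qed.

Lemma psi0 : psi 0 = 0. Proof. by rewrite /psi big_geq. Qed.
Lemma sum_ln0 : sum_ln 0 = 0. Proof. by rewrite /sum_ln big_geq. Qed.
Lemma harm0 : harm 0 = 0. Proof. by rewrite /harm big_geq. Qed.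

Lemma psi_le m n : (m <= n)%N -> psi m <= psi n.
Proof.
elim: n => [|n IH]; first by rewrite leqn0 => /eqP ->; lra.
rewrite leq_eqVlt => /orP[/eqP ->|/IH]; first lra.
by rewrite psiS; have := mangoldt_ge0 n.+1; lra.
Qed.

Lemma psi_ge0 n : 0 <= psi n.
Proof. by rewrite -psi0; apply: psi_le. Qed.

(** Stirling's formula, as [sum_ln N] is the logarithm of the factorial of [N].
    By [ln_incr_bounds] the increments of the middle expression lie between
    [0] and [ln (N + 1) - ln N]. *)
Lemma sum_ln_bounds N : (0 < N)%N ->
  0 <= sum_ln N - INR N * ln (INR N) + INR N <= 1 + ln (INR N).
Proof.
case: N => // N _; elim: N => [|N IH].
  by rewrite sum_lnS sum_ln0 /= ln_1; lra.
rewrite sum_lnS; have := ln_incr_bounds N.+1 isT; have := INR_ge1 N.+1 isT.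
move: IH; rewrite !(S_INR N.+1); move: (INR N.+1) => x IH x1 [h1 h2].
have : x * (ln (x + 1) - ln x) <= x * / x by apply: Rmult_le_compat_l; lra.
have : x * / (x + 1) <= x * (ln (x + 1) - ln x) by apply: Rmult_le_compat_l; lra.
have -> : x * / x = 1 by field; lra.
have -> : x * / (x + 1) = 1 - / (x + 1) by field; lra.
lra.
Qed.

Lemma sum_ln_mangoldt N : sum_ln N = \sum_(1 <= n < N.+1) mangoldt n * INR (N %/ n).
Proof.
rewrite /sum_ln big_nat.
transitivity (\sum_(1 <= n < N.+1) dsum (fun d _ => mangoldt d) n).
  by rewrite [RHS]big_nat; apply: eq_bigr => n /andP[n0 _]; rewrite dsum_mangoldt.
rewrite rsum_dsum; apply: eq_bigr => d _.
by rewrite rsum_const Rmult_comm.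
Qed.

Lemma sum_ln_psi N : sum_ln N = \sum_(1 <= n < N.+1) psi (N %/ n).
Proof.
rewrite sum_ln_mangoldt (rsum_pairsC N (fun _ m => mangoldt m)).
by apply: eq_bigr => n _; rewrite rsum_const Rmult_comm.
Qed.

(** Chebyshev's bound on one dyadic block: in [sum_ln N - 2 sum_ln (N/2)],
    written through [mangoldt], every coefficient is nonnegative and those of
    the [n] in the upper half are at least [1]. *)
Lemma psi_half N : psi N - psi (N %/ 2) <= sum_ln N - 2 * sum_ln (N %/ 2).
Proof.
set M := (N %/ 2)%N; have MN : (M <= N)%N by rewrite leq_div.
have -> : sum_ln M = \sum_(1 <= n < N.+1) mangoldt n * INR (M %/ n).
  rewrite sum_ln_mangoldt; symmetry; apply: rsum_widen; first lia.
  by move=> n /andP[h _]; rewrite divn_small //=; ring.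
have -> : psi M = \sum_(1 <= n < N.+1) (if (n <= M)%N then mangoldt n else 0).
  transitivity (\sum_(1 <= n < M.+1) (if (n <= M)%N then mangoldt n else 0)).
    rewrite /psi big_nat [RHS]big_nat; apply: eq_bigr => n.
    by rewrite ltnS => /andP[_ ->].
  symmetry; apply: rsum_widen; first lia.
  by move=> n /andP[h _]; rewrite leqNgt h.
rewrite sum_ln_mangoldt /psi -rsumZ -!rsumB; apply: ler_rsum => n /andP[n0 nN].
have := mangoldt_ge0 n => L0.
have D : (2 * (M %/ n) <= N %/ n)%N.
  rewrite leq_divRL // -mulnA.
  by have := leq_trunc_div M n; have := leq_trunc_div N 2; rewrite -/M; lia.
have := INR_leq _ _ D; rewrite INR_muln -[INR 2]/2 => D'.
case: ifP => h; first nra.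
have -> : (M %/ n = 0)%N by apply: divn_small; lia.
have := INR_ge1 (N %/ n); rewrite divn_gt0_le ?n0 // => /(_ isT) /=; nra.
Qed.

(** Adding up [psi_half] over [N], [N %/ 2], [N %/ 4], and so on. *)
Lemma chebyshev N : psi N <= 10 * INR N.
Proof.
elim/ltn_ind: N => N IH.
have [N1|N1] := leqP N 1.
  have [->|->] : (N = 0 \/ N = 1)%N by lia.
    by rewrite psi0 /=; lra.
  by rewrite psiS psi0 mangoldt1 /=; lra.
have h1 := psi_half N; have h2 := sum_ln_bounds N (ltnW N1).
have M0 : (0 < N %/ 2)%N by rewrite divn_gt0.
have h3 := sum_ln_bounds _ M0.
have := IH (N %/ 2)%N ltac:(lia).
have [] := INR_divn N 2 isT; rewrite -[INR 2]/2.
move: (INR_ge1 _ M0) (INR_ge1 _ (ltnW N1)) h1 h2 h3.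
move: (INR (N %/ 2)) (INR N) => m x m1 x1 h1 h2 h3 a b h4.
have c1 : ln x <= x - 1 by apply: ln_le_sub1; lra.
have c2 : ln x - ln m <= (x - m) / m by apply: ln_ratio_le; lra.
have c3 : m * (ln x - ln m) <= x - m.
  have -> : x - m = m * ((x - m) / m) by field; lra.
  by apply: Rmult_le_compat_l; lra.
have c4 : (x - 2 * m) * ln x <= 2 * ln x.
  by apply: Rmult_le_compat_r; [apply: ln_ge0|]; lra.
have c5 : x * ln x = (x - 2 * m) * ln x + 2 * (m * (ln x - ln m)) + 2 * (m * ln m) by ring.
lra.
Qed.

(** Mertens' first theorem. Multiplied by [N], the sum differs from [sum_ln N],
    written as in [sum_ln_mangoldt], only by the fractional parts of [N / n],
    whose total weight is at most [psi N]. *)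
Lemma mertens N : (0 < N)%N ->
  Rabs (\sum_(1 <= n < N.+1) mangoldt n / INR n - ln (INR N)) <= 11.
Proof.
move=> N0; have N1 := INR_ge1 _ N0; have C := chebyshev N.
have S := sum_ln_bounds N N0; rewrite sum_ln_mangoldt in S.
set s := \sum_(1 <= n < N.+1) mangoldt n / INR n.
set t := \sum_(1 <= n < N.+1) mangoldt n * INR (N %/ n) in S.
have L := ln_le_sub1 (INR N) ltac:(lra).
have h1 : t <= INR N * s.
  rewrite /s -rsumZ; apply: ler_rsum => n /andP[n0 _].
  have [h _] := INR_divn N n n0; have := mangoldt_ge0 n; have := INR_ge1 _ n0 => n1 L0.
  have -> : INR N * (mangoldt n / INR n) = mangoldt n * (INR N / INR n) by field; lra.
  by apply: Rmult_le_compat_l.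
have h2 : INR N * s <= t + psi N.
  rewrite /s -rsumZ /psi -rsumD; apply: ler_rsum => n /andP[n0 _].
  have [_ h] := INR_divn N n n0; have := mangoldt_ge0 n; have := INR_ge1 _ n0 => n1 L0.
  have -> : INR N * (mangoldt n / INR n) = mangoldt n * (INR N / INR n) by field; lra.
  by nra.
apply: Rabs_le; split; apply: (Rmult_le_reg_l (INR N)); lra.
Qed.

(** Euler's constant [g] is the common limit of the decreasing sequence
    [harm n - ln n] and the increasing sequence [harm n - ln n - / n]. *)
Lemma harm_bounds : exists g : R, (0 <= g <= 1) /\
  forall N, (0 < N)%N -> 0 <= harm N - ln (INR N) - g <= / INR N.
Proof.
pose u n := harm n - ln (INR n); pose v n := u n - / INR n.
have uS n : (0 < n)%N -> u n.+1 <= u n.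
  by move=> /ln_incr_bounds; rewrite /u harmS; lra.
have vS n : (0 < n)%N -> v n <= v n.+1.
  by move=> /ln_incr_bounds; rewrite /v /u harmS; lra.
have umono m n : (0 < m <= n)%N -> u n <= u m.
  elim: n => [|n IH]; first lia.
  move=> /andP[m0]; rewrite leq_eqVlt => /orP[/eqP ->|mn]; first lra.
  have := IH; rewrite m0 => /(_ mn); have := uS n; rewrite (leq_trans m0 mn) => /(_ isT).
  lra.
have vmono m n : (0 < m <= n)%N -> v m <= v n.
  elim: n => [|n IH]; first lia.
  move=> /andP[m0]; rewrite leq_eqVlt => /orP[/eqP ->|mn]; first lra.
  have := IH; rewrite m0 => /(_ mn); have := vS n; rewrite (leq_trans m0 mn) => /(_ isT).
  lra.
have vu m n : (0 < m)%N -> (0 < n)%N -> v m <= u n.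
  move=> m0 n0; have h1 := vmono m (maxn m n); have h2 := umono n (maxn m n).
  have : v (maxn m n) <= u (maxn m n).
    rewrite /v; have /INR_ge1 h : (0 < maxn m n)%N by lia.
    by have := Rinv_0_lt_compat (INR (maxn m n)); lra.
  by move: h1 h2; rewrite m0 n0 leq_maxl leq_maxr => /(_ isT) h1 /(_ isT); lra.
have u1 : u 1%N = 1 by rewrite /u harmS harm0 /= ln_1; field.
have v1 : v 1%N = 0 by rewrite /v u1 /=; field.
have Eb : bound (fun x => exists2 n, (0 < n)%N & x = v n).
  by exists 1 => x [n n0 ->]; rewrite -u1; apply: vu.
have [g [gub glub]] := completeness _ Eb (ex_intro _ _ (ex_intro2 _ _ 1%N isT erefl)).
have gv n : (0 < n)%N -> v n <= g by move=> n0; apply: gub; exists n.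
have gu n : (0 < n)%N -> g <= u n.
  by move=> n0; apply: glub => x [m m0 ->]; apply: vu.
exists g; split; first by have := gv 1%N isT; have := gu 1%N isT; lra.
by move=> N N0; have := gv N N0; have := gu N N0; rewrite /v /u; lra.
Qed.

Lemma harm_le N : (0 < N)%N -> ln (INR N) <= harm N <= 1 + ln (INR N).
Proof.
move=> N0; have [g [g01 h]] := harm_bounds.
have := h N N0; have := INR_ge1 _ N0 => h1 h2; split; first lra.
case: N N0 {h h1 h2} => // N _; elim: N => [|N IH].
  by rewrite harmS harm0 /= ln_1; lra.
by rewrite harmS; have := ln_incr_bounds N.+1 isT; lra.
Qed.

(** * Selberg's formula *)

(** The Tatuzawa-Iseki identity. Grouped by [k = d * m], the coefficient of
    [F k] is the sum of [moebius d * ln (N / d)] over the divisors [d] of [k];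
    with [ln (N / d) = ln (N / k) + ln (k / d)] this is [dsum_moebius] and
    [dsum_moebius_ln]. *)
Lemma tatuzawa_iseki N (F : nat -> R) : (0 < N)%N ->
  \sum_(1 <= d < N.+1) (moebius d * ln (INR N / INR d) *
     \sum_(1 <= m < (N %/ d).+1) F (d * m)%N) =
  F 1%N * ln (INR N) + \sum_(1 <= k < N.+1) mangoldt k * F k.
Proof.
move=> N0; have N1 := INR_ge1 _ N0.
transitivity (\sum_(1 <= d < N.+1) \sum_(1 <= m < (N %/ d).+1)
    moebius d * ln (INR N / INR d) * F (d * m)%N).
  by apply: eq_bigr => d _; rewrite rsumZ.
rewrite -rsum_dsum -[X in _ = X + _](@rsum_delta N 1) // -rsumD.
rewrite big_nat [RHS]big_nat; apply: eq_bigr => k /andP[k0 _].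
have k1 := INR_ge1 _ k0.
transitivity (dsum (fun d e => (F k * ln (INR N / INR k)) * moebius d +
    F k * (moebius d * ln (INR e))) k).
  apply: eq_dsum => // d e d0 e0 kE.
  have d1 := INR_ge1 _ d0; have e1 := INR_ge1 _ e0.
  rewrite -kE kE INR_muln !ln_div ?ln_mult //; try nra.
rewrite dsumD !dsumZ dsum_moebius // dsum_moebius_ln //.
by case: eqP => [->|_]; rewrite /= ?Rdiv_1_r; ring.
Qed.

(** With [y] the fourth root of [x], [ln x = 4 * ln y <= 4 * (y - 1)]. *)
Lemma ln1_sqr_le_sqrt x : 1 <= x -> (ln x + 1) * (ln x + 1) <= 16 * sqrt x.
Proof.
move=> x1; have s1 : 1 <= sqrt x by rewrite -sqrt_1; apply: sqrt_le_1_alt.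
set y := sqrt (sqrt x).
have y1 : 1 <= y by rewrite /y -sqrt_1; apply: sqrt_le_1_alt.
have sE : sqrt x = y * y by rewrite /y sqrt_sqrt; lra.
have -> : x = (y * y) * (y * y) by rewrite -sE sqrt_sqrt; lra.
rewrite !ln_mult ?sqrt_square; try nra.
have := ln_le_sub1 y; have := ln_ge0 y y1; nra.
Qed.

Lemma rsum_inv_sqrt_le N :
  \sum_(1 <= n < N.+1) / sqrt (INR n) <= 2 * sqrt (INR N).
Proof.
elim: N => [|N IH]; first by rewrite big_geq //= sqrt_0; lra.
rewrite rsum_recr //.
have := sqrt_sqrt _ (pos_INR N); have := sqrt_sqrt _ (pos_INR N.+1).
have := sqrt_le_1_alt _ _ (INR_leq _ _ (leqnSn N)).
have := sqrt_lt_R0 _ (lt_0_INR N.+1 ltac:(lia)).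
have := sqrt_pos (INR N); rewrite {5}S_INR.
move: IH; move: (sqrt (INR N)) (sqrt (INR N.+1)) => b a IH b0 a0 ba aa bb.
suff : / a <= 2 * (a - b) by lra.
apply: (Rmult_le_reg_l a) => //; rewrite Rinv_r; nra.
Qed.

Definition err (N : nat) : R := psi N - INR N.

Lemma err0 : err 0 = 0. Proof. by rewrite /err psi0 /=; ring. Qed.

Lemma err_abs_le N : Rabs (err N) <= 10 * INR N.
Proof.
have := chebyshev N; have := psi_ge0 N; have := pos_INR N => *.
by apply: Rabs_le; rewrite /err; lra.
Qed.

(** With [g] Euler's constant, the constant [g + 1] is the one for which the
    main terms [x ln x] and [x] of [sum_ln_psi] and of [harm] cancel, and only a
    logarithmic error remains. *)
Lemma tatuzawa_weight_le g N d : 0 <= g <= 1 ->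
  (forall n, (0 < n)%N -> 0 <= harm n - ln (INR n) - g <= / INR n) ->
  (0 < d <= N)%N ->
  Rabs (\sum_(1 <= m < (N %/ d).+1)
          (psi (N %/ (d * m)) - INR N / INR (d * m)%N + (g + 1)))
  <= 2 * (ln (INR N / INR d) + 1).
Proof.
move=> g01 gP /andP[d0 dN]; have d1 := INR_ge1 _ d0.
have [] := INR_divn N d d0; have M0 : (0 < N %/ d)%N by rewrite divn_gt0.
set M := (N %/ d)%N; set x := INR N / INR d => h1 h2.
have -> : \sum_(1 <= m < M.+1)
    (psi (N %/ (d * m)) - INR N / INR (d * m)%N + (g + 1)) =
    sum_ln M - x * harm M + INR M * (g + 1).
  rewrite sum_ln_psi /harm -rsumZ -rsum_const -rsumB -rsumD.
  rewrite big_nat [RHS]big_nat; apply: eq_bigr => m /andP[m0 _].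
  have m1 := INR_ge1 _ m0; rewrite divnMA INR_muln -/M /x; field; lra.
have S := sum_ln_bounds M M0; have G := gP M M0; have H := harm_le M M0.
have M1 : 1 <= INR M := INR_ge1 _ M0.
have L : ln (INR M) <= ln x by apply: ln_le; lra.
have L0 : 0 <= ln (INR M) := ln_INR_ge0 _ M0.
have E1 : INR M * / INR M = 1 by field; lra.
have E2 : x * harm M = INR M * ln (INR M) + INR M * g
   + INR M * (harm M - ln (INR M) - g) + (x - INR M) * harm M by ring.
have E3 : 0 <= INR M * (harm M - ln (INR M) - g) <= 1 by split; nra.
have E4 : 0 <= (x - INR M) * harm M <= 1 + ln (INR M) by split; nra.
by apply: Rabs_le; lra.
Qed.

(** Selberg's formula: [tatuzawa_iseki] for
    [F k = psi (N %/ k) - N / k + (g + 1)]. The weight of each [moebius d] is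
    [O(ln (N / d) ^ 2)] by [tatuzawa_weight_le], hence [O(sqrt (N / d))], and
    these add up to [O(N)] whatever the signs of [moebius d]. Passing from [F]
    to [err] costs [O(N)] by Chebyshev's bound. *)
Lemma selberg_err N : (0 < N)%N ->
  Rabs (err N * ln (INR N) + \sum_(1 <= n < N.+1) mangoldt n * err (N %/ n))
  <= 100 * INR N.
Proof.
move=> N0; have N1 := INR_ge1 _ N0.
have [g [g01 gP]] := harm_bounds.
pose F k := psi (N %/ k) - INR N / INR k + (g + 1).
have B : Rabs (F 1%N * ln (INR N) + \sum_(1 <= k < N.+1) mangoldt k * F k)
    <= 64 * INR N.
  rewrite -tatuzawa_iseki //; apply: Rle_trans (rsum_abs _ _ _) _.
  have -> : 64 * INR N = 32 * sqrt (INR N) * (2 * sqrt (INR N)).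
    by rewrite -{1}(sqrt_sqrt (INR N)); lra.
  apply: Rle_trans (Rmult_le_compat_l _ _ _ _ (rsum_inv_sqrt_le N)); last first.
    by have := sqrt_pos (INR N); lra.
  rewrite -rsumZ; apply: ler_rsum => d /andP[d0 dN].
  have d1 := INR_ge1 _ d0; have dN' := INR_leq d N dN.
  have x1 : 1 <= INR N / INR d.
    by apply: (Rmult_le_reg_r (INR d)); [lra|field_simplify; lra].
  have -> : 32 * sqrt (INR N) * / sqrt (INR d) = 2 * (16 * sqrt (INR N / INR d)).
    by rewrite sqrt_div_alt; [field; have := sqrt_lt_R0 (INR d)|]; lra.
  have := ln1_sqr_le_sqrt _ x1; have := ln_ge0 _ x1.
  have := tatuzawa_weight_le g N d g01 gP; rewrite d0 -ltnS dN => /(_ isT).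
  have := moebius_abs_le1 d.
  rewrite !Rabs_mult => h1 h2 h3; rewrite (Rabs_pos_eq _ h3) => h4.
  have := Rabs_pos (moebius d).
  set S := Rabs (\sum_(1 <= _ < _) _) in h2 *.
  have S0 : 0 <= S by apply: Rabs_pos.
  move: h1 h2 h3 h4 S0; set l := ln _; set a := Rabs (moebius d); set q := sqrt _.
  move=> *; have : a * l <= l by nra.
  have : 0 <= a * l by nra.
  nra.
have E : err N * ln (INR N) + \sum_(1 <= n < N.+1) mangoldt n * err (N %/ n) =
  (F 1%N * ln (INR N) + \sum_(1 <= k < N.+1) mangoldt k * F k)
  - ((g + 1) * ln (INR N) + \sum_(1 <= k < N.+1)
      mangoldt k * ((g + 1) - (INR N / INR k - INR (N %/ k)))).
  have -> : F 1%N = err N + (g + 1) by rewrite /F /err divn1 /= Rdiv_1_r; ring.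
  have -> : \sum_(1 <= k < N.+1) mangoldt k * F k =
      \sum_(1 <= k < N.+1) mangoldt k * err (N %/ k) + \sum_(1 <= k < N.+1)
      mangoldt k * ((g + 1) - (INR N / INR k - INR (N %/ k))).
    by rewrite -rsumD; apply: eq_bigr => k _; rewrite /F /err; ring.
  ring.
have S0 : 0 <= \sum_(1 <= k < N.+1)
      mangoldt k * ((g + 1) - (INR N / INR k - INR (N %/ k))) <= 2 * psi N.
  split.
    apply: rsum_ge0 => k /andP[k0 _]; have := INR_divn N k k0; have := mangoldt_ge0 k.
    by move=> *; apply: Rmult_le_pos; lra.
  rewrite /psi -rsumZ; apply: ler_rsum => k /andP[k0 _].
  have := INR_divn N k k0; have := mangoldt_ge0 k; nra.
have C := chebyshev N; have L := ln_le_id (INR N) ltac:(lra).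
have L0 := ln_INR_ge0 _ N0.
have gl : 0 <= (g + 1) * ln (INR N) <= 2 * INR N by split; nra.
by rewrite E; move/Rabs_le_between: B => B; apply: Rabs_le; lra.
Qed.

(** * An inequality for the error term *)

(** Selberg's weight: the convolution of the Moebius function with [ln ^ 2]. *)
Definition mangoldt2 (n : nat) : R :=
  mangoldt n * ln (INR n) + dsum (fun d e => mangoldt d * mangoldt e) n.

Lemma dsum_mangoldt_mangoldt_ge0 n : 0 <= dsum (fun d e => mangoldt d * mangoldt e) n.
Proof.
rewrite /dsum rsum_mkcond; apply: rsum_ge0 => d _; case: ifP => _; last lra.
by have := mangoldt_ge0 d; have := mangoldt_ge0 (n %/ d); nra.
Qed.

Lemma rsum_mangoldt_ln N : (0 < N)%N ->
  Rabs (\sum_(1 <= n < N.+1) mangoldt n * ln (INR n) - psi N * ln (INR N))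
  <= 10 * INR N.
Proof.
move=> N0; have N1 := INR_ge1 _ N0.
rewrite (rsum_abel N mangoldt (fun n => ln (INR n))).
set S := \sum_(1 <= n < N.+1) _; rewrite -/(psi N).
have term n : (0 < n)%N -> 0 <= psi n * (ln (INR n.+1) - ln (INR n)) <= 10.
  move=> n0; have n1 := INR_ge1 _ n0; have := ln_incr_bounds n n0.
  have := chebyshev n; have := psi_ge0 n; have : 0 < / INR n.+1.
    by apply: Rinv_0_lt_compat; have := INR_ge1 n.+1 isT; lra.
  have E : INR n * / INR n = 1 by field; lra.
  by move=> *; split; nra.
have S0 : - (10 * INR N) <= S <= 0.
  split.
    have -> : - (10 * INR N) = \sum_(1 <= n < N.+1) - 10 by rewrite rsum_const; ring.
    by apply: ler_rsum => n /andP[/term h _]; rewrite -/(psi n); lra.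
  rewrite -(Rmult_0_r (INR N)) -rsum_const.
  by apply: ler_rsum => n /andP[/term h _]; rewrite -/(psi n); lra.
by have := term N N0 => h; apply: Rabs_le; lra.
Qed.

(** In [selberg_err] the sum of [mangoldt n * err (N %/ n)] is the sum of
    [mangoldt n * psi (N %/ n)] minus [sum_ln N], and summation by parts turns
    [psi N * ln N] into the sum of [mangoldt n * ln n]. *)
Lemma selberg_mangoldt2 N : (0 < N)%N ->
  Rabs (\sum_(1 <= n < N.+1) (mangoldt2 n - 2 * ln (INR n))) <= 120 * INR N.
Proof.
move=> N0; have N1 := INR_ge1 _ N0.
have := selberg_err N N0; have := rsum_mangoldt_ln N N0; have := sum_ln_bounds N N0.
have -> : \sum_(1 <= n < N.+1) mangoldt n * err (N %/ n) =
    \sum_(1 <= n < N.+1) mangoldt n * psi (N %/ n) - sum_ln N.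
  by rewrite sum_ln_mangoldt -rsumB; apply: eq_bigr => n _; rewrite /err; ring.
rewrite rsumB rsumZ -/(sum_ln N) /mangoldt2 rsumD rsum_dsum.
have -> : \sum_(1 <= d < N.+1) \sum_(1 <= m < (N %/ d).+1) mangoldt d * mangoldt m =
    \sum_(1 <= n < N.+1) mangoldt n * psi (N %/ n).
  by apply: eq_bigr => d _; rewrite rsumZ.
rewrite /err; have L := ln_le_sub1 (INR N) ltac:(lra).
move=> S /Rabs_le_between h1 /Rabs_le_between h2.
by apply: Rabs_le; lra.
Qed.

(** The convolution part of [mangoldt2] is nonnegative, so that
    [mangoldt n * ln n] is at most [mangoldt2 n], whose sums are known up to
    [O(y)]. *)
Lemma psi_short x y : (1 < x <= y)%N ->
  (psi y - psi x) * ln (INR x) <= 2 * (INR y - INR x) * ln (INR y) + 240 * INR y.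
Proof.
move=> /andP[x1 xy]; have x0 := ltnW x1; have y0 := leq_trans x0 xy.
have ly n : (0 < n <= y)%N -> ln (INR n) <= ln (INR y).
  by move=> /andP[/INR_ge1 h /INR_leq h']; apply: ln_le; lra.
have lx n : (x <= n)%N -> ln (INR x) <= ln (INR n).
  by move=> /INR_leq h; apply: ln_le => //; have := INR_ge1 _ x0; lra.
have h1 := selberg_mangoldt2 y y0; have h2 := selberg_mangoldt2 x x0.
move: h1; rewrite (rsum_cat 1 x.+1 y.+1) //.
have -> : psi y - psi x = \sum_(x.+1 <= n < y.+1) mangoldt n.
  by rewrite /psi (rsum_cat 1 x.+1 y.+1) //; ring.
rewrite [_ * ln (INR x)]Rmult_comm -rsumZ => h1.
have := INR_leq _ _ xy; move: h1 h2.
set S := \sum_(x.+1 <= n < y.+1) (mangoldt2 n - _).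
set U := \sum_(1 <= n < x.+1) (mangoldt2 n - _)
  => /Rabs_le_between h1 /Rabs_le_between h2 hxy.
suff : \sum_(x.+1 <= i < y.+1) ln (INR x) * mangoldt i <=
    S + (INR y.+1 - INR x.+1) * (2 * ln (INR y)) by rewrite !S_INR; lra.
rewrite -rsum_const_ge // -rsumD; apply: ler_rsum => n /andP[xn ny].
have := lx n (ltnW xn); have := ly n ltac:(lia).
have := mangoldt_ge0 n; have := dsum_mangoldt_mangoldt_ge0 n; rewrite /mangoldt2; nra.
Qed.

(** [selberg_err] at [N], multiplied by [ln N], in which [selberg_err] at every
    [N %/ n] is substituted: [ln N] splits as [ln n + ln (N %/ n)] up to an
    error [e n] of size [/ (N %/ n)]. *)
Lemma err_ln_sqr_le_mangoldt2 N : (0 < N)%N ->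
  Rabs (err N) * (ln (INR N) * ln (INR N)) <=
  \sum_(1 <= n < N.+1) mangoldt2 n * Rabs (err (N %/ n))
  + 200 * INR N * (ln (INR N) + 1).
Proof.
move=> N0; have N1 := INR_ge1 _ N0; have L0 := ln_INR_ge0 _ N0.
set l := ln (INR N) in L0 *.
pose s k := err k * ln (INR k) + \sum_(1 <= n < k.+1) mangoldt n * err (k %/ n).
pose e n := l - ln (INR n) - ln (INR (N %/ n)).
pose A := \sum_(1 <= n < N.+1) mangoldt n * ln (INR n) * err (N %/ n).
pose B := \sum_(1 <= n < N.+1) dsum (fun d e => mangoldt d * mangoldt e) n * err (N %/ n).
pose T := \sum_(1 <= n < N.+1) mangoldt n * s (N %/ n)%N.
pose V := \sum_(1 <= n < N.+1) mangoldt n * (e n * err (N %/ n)).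
have sB k : (0 < k)%N -> Rabs (s k) <= 100 * INR k by exact: selberg_err.
have BE : B = \sum_(1 <= n < N.+1) mangoldt n *
    \sum_(1 <= m < (N %/ n).+1) mangoldt m * err (N %/ n %/ m).
  transitivity (\sum_(1 <= k < N.+1)
      dsum (fun d e => mangoldt d * mangoldt e * err (N %/ (d * e))) k).
    rewrite /B big_nat [RHS]big_nat; apply: eq_bigr => k /andP[k0 _].
    rewrite Rmult_comm -dsumZ; apply: eq_dsum => // d e' _ _ ->; ring.
  rewrite rsum_dsum; apply: eq_bigr => d _; rewrite -rsumZ.
  by apply: eq_bigr => m _; rewrite divnMA; ring.
have E : err N * (l * l) = B - A - V + l * s N - T.
  have -> : T = \sum_(1 <= n < N.+1) mangoldt n * err (N %/ n) * ln (INR (N %/ n)) + B.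
    by rewrite BE -rsumD; apply: eq_bigr => n _; rewrite /s; ring.
  have -> : V = l * \sum_(1 <= n < N.+1) mangoldt n * err (N %/ n) - A -
      \sum_(1 <= n < N.+1) mangoldt n * err (N %/ n) * ln (INR (N %/ n)).
    by rewrite -rsumZ -!rsumB; apply: eq_bigr => n _; rewrite /e; ring.
  by rewrite /s -/l; ring.
have hV : Rabs V <= 100 * INR N.
  apply: Rle_trans (rsum_abs _ _ _) _.
  apply: (Rle_trans _ (10 * psi N)); last by have := chebyshev N; lra.
  rewrite /psi -rsumZ; apply: ler_rsum => n /andP[n0 nN].
  have n1 := INR_ge1 _ n0; have M0 : (0 < N %/ n)%N by rewrite divn_gt0.
  have M1 := INR_ge1 _ M0; have [d1 d2] := INR_divn N n n0.
  have eE : e n = ln (INR N / INR n) - ln (INR (N %/ n)).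
    by rewrite /e ln_div //; lra.
  have e0 : 0 <= e n by rewrite eE; have := ln_le (INR (N %/ n)) _ ltac:(lra) d1; lra.
  have e1 : e n * INR (N %/ n) <= 1.
    have := ln_ratio_le (INR (N %/ n)) (INR N / INR n) ltac:(lra) ltac:(lra).
    rewrite -eE => h; have := Rmult_le_compat_r (INR (N %/ n)) _ _ ltac:(lra) h.
    have -> : (INR N / INR n - INR (N %/ n)) / INR (N %/ n) * INR (N %/ n) =
      INR N / INR n - INR (N %/ n) by field; lra.
    lra.
  have L := mangoldt_ge0 n; rewrite !Rabs_mult (Rabs_pos_eq _ L) (Rabs_pos_eq _ e0).
  have := err_abs_le (N %/ n) => h.
  have : e n * Rabs (err (N %/ n)) <= 10 by nra.
  by nra.
have hT : Rabs T <= 100 * INR N * l.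
  apply: Rle_trans (rsum_abs _ _ _) _.
  apply: (Rle_trans _ (100 * sum_ln N)); last first.
    have := sum_ln_bounds N N0; have := ln_le_sub1 (INR N) ltac:(lra).
    by rewrite -/l; lra.
  rewrite sum_ln_mangoldt -rsumZ; apply: ler_rsum => n /andP[n0 nN].
  have L := mangoldt_ge0 n; rewrite !Rabs_mult (Rabs_pos_eq _ L).
  by have := sB (N %/ n)%N; rewrite divn_gt0_le ?n0 // => /(_ isT); nra.
have hs : Rabs (l * s N) <= 100 * INR N * l.
  by rewrite Rabs_mult (Rabs_pos_eq l) //; have := sB N N0; nra.
have hAB : Rabs (B - A) <= \sum_(1 <= n < N.+1) mangoldt2 n * Rabs (err (N %/ n)).
  rewrite /A /B -rsumB; apply: Rle_trans (rsum_abs _ _ _) _.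
  apply: ler_rsum => n /andP[n0 _]; rewrite /mangoldt2.
  have h1 := dsum_mangoldt_mangoldt_ge0 n; have h2 := mangoldt_ge0 n.
  have h3 := ln_INR_ge0 _ n0.
  rewrite -Rmult_minus_distr_r Rabs_mult.
  apply: Rmult_le_compat_r; first exact: Rabs_pos.
  by apply: Rabs_le; nra.
rewrite -(Rabs_pos_eq (l * l)) -?Rabs_mult ?E; last by nra.
move/Rabs_le_between: hV => hV; move/Rabs_le_between: hT => hT.
move/Rabs_le_between: hs => hs; move/Rabs_le_between: hAB => hAB.
by apply: Rabs_le; lra.
Qed.

(** By [selberg_mangoldt2] the weight [mangoldt2 n] can be replaced by its
    average after summation by parts. The variation of [n |-> err (N %/ n)] is
    dominated by that of the monotone [g], and the variation of [g] weighted by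
    [n] is the sum of [g]. *)
Lemma rsum_mangoldt2_err_le N : (0 < N)%N ->
  \sum_(1 <= n < N.+1) mangoldt2 n * Rabs (err (N %/ n)) <=
  2 * \sum_(1 <= n < N.+1) ln (INR n) * Rabs (err (N %/ n))
  + 240 * INR N * (ln (INR N) + 1).
Proof.
move=> N0; have N1 := INR_ge1 _ N0; have L0 := ln_INR_ge0 _ N0.
pose b n := Rabs (err (N %/ n)).
pose g n := psi (N %/ n) + INR (N %/ n).
have bN : b N.+1 = 0 by rewrite /b divn_small // err0 Rabs_R0.
have gN : g N.+1 = 0 by rewrite /g divn_small // psi0 /=; ring.
suff : \sum_(1 <= n < N.+1) (mangoldt2 n - 2 * ln (INR n)) * b n <=
    240 * INR N * (ln (INR N) + 1).
  rewrite -rsumZ.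
  have -> : \sum_(1 <= n < N.+1) (mangoldt2 n - 2 * ln (INR n)) * b n =
    \sum_(1 <= n < N.+1) mangoldt2 n * b n -
    \sum_(1 <= n < N.+1) 2 * (ln (INR n) * b n).
    by rewrite -rsumB; apply: eq_bigr => n _; ring.
  by rewrite /b; lra.
rewrite (rsum_abel N (fun n => mangoldt2 n - 2 * ln (INR n)) b) bN Rmult_0_r Rplus_0_r.
have G : \sum_(1 <= n < N.+1) INR n * (g n - g n.+1) <= 2 * INR N * (ln (INR N) + 1).
  have E := rsum_abel N (fun=> 1) g.
  have -> : \sum_(1 <= n < N.+1) INR n * (g n - g n.+1) = \sum_(1 <= n < N.+1) 1 * g n.
    rewrite E gN Rmult_0_r Rplus_0_r; apply: eq_bigr => n _.
    by rewrite rsum_const Rmult_1_r.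
  apply: (Rle_trans _ (sum_ln N + INR N * harm N)); last first.
    have := sum_ln_bounds N N0; have := ln_le_sub1 (INR N) ltac:(lra).
    have := harm_le N N0; nra.
  rewrite sum_ln_psi /harm -rsumZ -rsumD; apply: ler_rsum => n /andP[n0 _].
  by have := INR_divn N n n0; rewrite /g /Rdiv; lra.
apply: (Rle_trans _ (120 * \sum_(1 <= n < N.+1) INR n * (g n - g n.+1))); last lra.
rewrite -rsumZ; apply: ler_rsum => n /andP[n0 _].
have D : Rabs (b n - b n.+1) <= g n - g n.+1.
  have le : (N %/ n.+1 <= N %/ n)%N by apply: leq_div2l.
  apply: Rle_trans (Rabs_triang_inv2 _ _) _.
  rewrite /err /g; have := psi_le _ _ le; have := INR_leq _ _ le => *.
  by apply: Rabs_le; lra.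
apply: Rle_trans (Rle_abs _) _; rewrite Rabs_mult.
have := selberg_mangoldt2 n n0; have := Rabs_pos (b n - b n.+1).
set q := Rabs (\sum_(_ <= _ < _) _); have : 0 <= q by apply: Rabs_pos.
have := INR_ge1 _ n0.
by move=> *; apply: (Rle_trans _ (120 * INR n * Rabs (b n - b n.+1))); nra.
Qed.

Lemma err_ln_sqr_le N : (0 < N)%N ->
  Rabs (err N) * (ln (INR N) * ln (INR N)) <=
  2 * \sum_(1 <= n < N.+1) ln (INR n) * Rabs (err (N %/ n))
  + 440 * INR N * (ln (INR N) + 1).
Proof.
by move=> N0; have := err_ln_sqr_le_mangoldt2 N N0; have := rsum_mangoldt2_err_le N N0; lra.
Qed.

(** Summation by parts reduces this to [mertens] and [harm_le], whose main
    terms [ln N] cancel. *)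
Lemma rsum_err_bounded N :
  Rabs (\sum_(1 <= k < N.+1) err k * (/ INR k - / INR k.+1)) <= 23.
Proof.
have [->|N0] := posnP N; first by rewrite big_geq // Rabs_R0; lra.
have N1 := INR_ge1 _ N0.
have E1 := rsum_abel N mangoldt (fun n => / INR n).
have E2 := rsum_abel N (fun=> 1) (fun n => / INR n).
have -> : \sum_(1 <= k < N.+1) err k * (/ INR k - / INR k.+1) =
  (\sum_(1 <= n < N.+1) mangoldt n / INR n - psi N * / INR N.+1)
  - (harm N - INR N * / INR N.+1).
  have -> : harm N = \sum_(1 <= n < N.+1) 1 * / INR n.
    by apply: eq_bigr => n _; rewrite Rmult_1_l.
  rewrite /Rdiv E1 E2 rsum_const Rmult_1_r -/(psi N).
  have -> : \sum_(1 <= k < N.+1) err k * (/ INR k - / INR k.+1) =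
    \sum_(1 <= n < N.+1) psi n * (/ INR n - / INR n.+1)
    - \sum_(1 <= n < N.+1) (\sum_(1 <= i < n.+1) 1) * (/ INR n - / INR n.+1).
    rewrite -rsumB; apply: eq_bigr => n _; rewrite rsum_const /err; ring.
  by rewrite /psi; ring.
have /Rabs_le_between M := mertens N N0; have H := harm_le N N0.
have C := chebyshev N; have P := psi_ge0 N.
have I0 : 0 < / INR N.+1 by apply: Rinv_0_lt_compat; rewrite S_INR; lra.
have I1 : INR N * / INR N.+1 <= 1.
  by apply: (Rmult_le_reg_r (INR N.+1)); rewrite ?S_INR; [|field_simplify]; lra.
have : 0 <= psi N * / INR N.+1 <= 10 by split; nra.
have : 0 <= INR N * / INR N.+1 by nra.
by move=> *; apply: Rabs_le; lra.
Qed.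

Lemma rsum_err_interval_bounded m n : (0 < m <= n)%N ->
  Rabs (\sum_(m <= k < n) err k * (/ INR k - / INR k.+1)) <= 46.
Proof.
case: m n => // m [|n] // mn.
have /Rabs_le_between h1 := rsum_err_bounded m; have /Rabs_le_between := rsum_err_bounded n.
rewrite (rsum_cat 1 m.+1 n.+1) // => h2.
by apply: Rabs_le; lra.
Qed.

(** * Intervals where the error term is small *)

Lemma INR_above x : exists n : nat, x <= INR n.
Proof.
have [x0|x0] := Rle_lt_dec x 0; first by exists 0%N.
by have [n hn] := nfloor_ex x ltac:(lra); exists n.+1; rewrite S_INR; lra.
Qed.

Lemma ln_le_linear e : 0 < e -> exists n0, forall n, (n0 <= n)%N -> ln (INR n) <= e * INR n.
Proof.
move=> e0; have [n0 h0] := INR_above ((2 / e) * (2 / e) + 1).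
exists n0 => n /INR_leq hn; have E0 : 0 < 2 / e by apply: Rdiv_lt_0_compat; lra.
have x1 : 2 / e * (2 / e) <= INR n by lra.
have x0 : 1 <= INR n by nra.
have s1 : 2 / e <= sqrt (INR n).
  by rewrite -(sqrt_square (2 / e)); [apply: sqrt_le_1_alt|lra].
have e1 : 2 <= e * sqrt (INR n).
  have -> : 2 = e * (2 / e) by field; lra.
  by apply: Rmult_le_compat_l; lra.
have l1 := ln_le_id (sqrt (INR n)) ltac:(lra).
suff : ln (sqrt (INR n) * sqrt (INR n)) <= e * (sqrt (INR n) * sqrt (INR n)).
  by rewrite sqrt_sqrt; lra.
have E2 : 0 < 2 / e by lra.
rewrite ln_mult; try lra.
by have := Rmult_le_compat_r (sqrt (INR n)) _ _ ltac:(lra) e1; lra.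
Qed.

Lemma ln_ge_eventually A : exists2 n0, (0 < n0)%N & forall n, (n0 <= n)%N -> A <= ln (INR n).
Proof.
have [n0 h0] := INR_above (exp A); exists n0.+1 => // n /INR_leq; rewrite S_INR => hn.
by rewrite -(ln_exp A); apply: ln_le; [apply: exp_pos|lra].
Qed.

Lemma errS n : err n.+1 = err n + mangoldt n.+1 - 1.
Proof. by rewrite /err psiS S_INR; ring. Qed.

(** From [n] to [n + 1], [err] drops by at most [1] and rises by at most
    [ln (n + 1)]; both are small compared with [d * n]. *)
Lemma err_same_sign d : 0 < d -> exists k0, forall n, (k0 <= n)%N ->
  d * INR n < Rabs (err n) -> d * INR n.+1 < Rabs (err n.+1) ->
  (0 < err n <-> 0 < err n.+1).
Proof.
move=> d0; have [n0 h0] := ln_le_linear d d0; have [n1 h1] := INR_above (/ d).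
exists (maxn n0 n1) => n hn; have {}h0 := h0 n.+1 ltac:(lia).
have := INR_leq n1 n ltac:(lia) => h2.
have dn : 1 <= d * INR n.
  by rewrite -(Rinv_r d); [apply: Rmult_le_compat_l|]; lra.
have := mangoldt_ge0 n.+1; have := mangoldt_le_ln n.+1 isT; rewrite errS.
move: h0; rewrite S_INR; move: (mangoldt n.+1) (err n) (ln _) => L e l hl hL L0.
by rewrite /Rabs; case: Rcase_abs; case: Rcase_abs => *; split; lra.
Qed.

(** If [err] stayed large from [a] to [K * a] it would keep a constant sign
    there, and its weighted sum over this range, at least [d * ln (K / 2)],
    would exceed the bound of [rsum_err_interval_bounded]. *)
Lemma err_small_point d : 0 < d -> exists K k0, (0 < K)%N /\
  forall a, (k0 <= a)%N -> exists2 n, (a <= n < K * a)%N & Rabs (err n) <= d * INR n.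
Proof.
move=> d0; have [k1 hk1] := err_same_sign d d0.
(* With this [K], [d * ln (K / 2)] is at least 47, beyond the bound 46 of
   [rsum_err_interval_bounded]. *)
have [K hK] := INR_above (2 * exp (47 / d)).
have eK := exp_pos (47 / d).
have K0 : (0 < K)%N by case: K hK => //=; lra.
exists K, k1.+1; split=> // a ka.
have [//|no] := Classical_Prop.classic
  (exists2 n, (a <= n < K * a)%N & Rabs (err n) <= d * INR n).
have big n : (a <= n < K * a)%N -> d * INR n < Rabs (err n).
  by move=> h; apply: Rnot_le_lt => h'; apply: no; exists n.
have sgn n : (a <= n < K * a)%N -> (0 < err a <-> 0 < err n).
  elim: n => [|n IH]; first by rewrite leqn0 => /andP[/eqP -> _].
  rewrite leq_eqVlt => /andP[/orP[/eqP ->|an] nK] //.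
  rewrite IH; last by lia.
  by apply: hk1; [lia | apply: big; lia | apply: big; lia].
have a0 : (0 < a)%N by lia.
have a1 := INR_ge1 _ a0; have K1 := INR_ge1 _ K0.
have aK : (a <= K * a)%N by rewrite leq_pmull.
have wpos k : (0 < k)%N -> 0 < / INR k - / INR k.+1.
  move=> /INR_ge1 k1'; rewrite S_INR.
  by have -> : / INR k - / (INR k + 1) = / (INR k * (INR k + 1));
    [field; lra | apply: Rinv_0_lt_compat; nra].
have S : Rabs (\sum_(a <= k < K * a) err k * (/ INR k - / INR k.+1)) =
    \sum_(a <= k < K * a) Rabs (err k) * (/ INR k - / INR k.+1).
  have P : 0 <= \sum_(a <= k < K * a) Rabs (err k) * (/ INR k - / INR k.+1).
    apply: rsum_ge0 => k /andP[ak _]; have := wpos k (leq_trans a0 ak).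
    by have := Rabs_pos (err k); nra.
  case: (Rlt_dec 0 (err a)) => sa.
    rewrite -[RHS]Rabs_pos_eq //; congr Rabs.
    rewrite big_nat [RHS]big_nat; apply: eq_bigr => k /sgn h.
    by rewrite Rabs_pos_eq //; tauto || (have : 0 < err k by tauto); lra.
  rewrite -[RHS]Rabs_pos_eq // -Rabs_Ropp; congr Rabs.
  rewrite -[LHS]Rmult_1_l Ropp_mult_distr_r_reverse Ropp_mult_distr_l -rsumZ.
  rewrite big_nat [RHS]big_nat; apply: eq_bigr => k /sgn h.
  by rewrite Rabs_left1; [ring | apply: Rnot_lt_le; tauto].
have := rsum_err_interval_bounded a (K * a)%N; rewrite a0 aK S => /(_ isT) U.
have L : d * (ln (INR (K * a).+1) - ln (INR a.+1)) <=
    \sum_(a <= k < K * a) Rabs (err k) * (/ INR k - / INR k.+1).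
  rewrite -(rsum_telescope a (K * a) (fun k => ln (INR k.+1))) // -rsumZ.
  apply: ler_rsum => k hk; have k0 : (0 < k)%N by lia.
  have := big k hk; have := wpos k k0; have [_ h] := ln_incr_bounds k.+1 isT.
  have k1' := INR_ge1 _ k0 => w b.
  have : d * INR k * (/ INR k - / INR k.+1) <= Rabs (err k) * (/ INR k - / INR k.+1).
    by apply: Rmult_le_compat_r; lra.
  have -> : d * INR k * (/ INR k - / INR k.+1) = d * / INR k.+1.
    by rewrite S_INR; field; lra.
  have : d * (ln (INR k.+2) - ln (INR k.+1)) <= d * / INR k.+1.
    by apply: Rmult_le_compat_l; lra.
  lra.
have Q : 47 / d <= ln (INR (K * a).+1) - ln (INR a.+1).
  rewrite -(ln_exp (47 / d)) -ln_div; try (rewrite S_INR; have := pos_INR (K * a); lra).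
  apply: ln_le => //; apply: (Rmult_le_reg_r (INR a.+1)); first by rewrite S_INR; lra.
  have -> : INR (K * a).+1 / INR a.+1 * INR a.+1 = INR (K * a).+1.
    by field; rewrite S_INR; lra.
  rewrite !S_INR INR_muln; nra.
have : d * (47 / d) <= 46.
  by apply: Rle_trans U; apply: Rle_trans L; apply: Rmult_le_compat_l; lra.
have -> : d * (47 / d) = 47 by field; lra.
lra.
Qed.

(** Around a point where [err] is small it remains small: downwards because
    [psi] increases, upwards by the bound on primes in short intervals. *)
Lemma err_small_near d : 0 < d <= 1 -> exists k0, forall n m, (k0 <= n <= m)%N ->
  Rabs (err n) <= d * INR n -> INR m <= (1 + d / 2) * INR n ->
  Rabs (err m) <= 2 * d * INR m.
Proof.
move=> d01.
(* In [psi_short] with [m <= 2 * n] the error is at most 482 * n, which has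
   to be below [d / 2 * n * ln n]. *)
have [n0 _ h0] := ln_ge_eventually (964 / d).
exists (maxn n0 2) => n m /andP[kn nm] en mn.
have n0' : (0 < n)%N by lia.
have n1 := INR_ge1 _ n0'; have nm' := INR_leq _ _ nm.
have l0 := h0 n ltac:(lia).
have D : d * ln (INR n) >= 964.
  have -> : 964 = d * (964 / d) by field; lra.
  by apply: Rle_ge; apply: Rmult_le_compat_l; lra.
have ln0 : 0 < ln (INR n) by nra.
have P := psi_short n m ltac:(lia); have Pm := psi_le _ _ nm.
have l1 : ln (INR m) <= ln (INR n) + 1.
  have := ln_ratio_le (INR n) (INR m) ltac:(lra) ltac:(lra).
  have : (INR m - INR n) / INR n <= 1.
    by apply: (Rmult_le_reg_r (INR n)); [lra|field_simplify; nra].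
  lra.
have up : psi m - psi n <= 2 * (INR m - INR n) + d / 2 * INR n.
  apply: (Rmult_le_reg_r (ln (INR n))) => //; nra.
move/Rabs_le_between: en => en; apply: Rabs_le; rewrite /err in en *.
split; nra.
Qed.

(** [err_small_point] and [err_small_near] together, with the interval written
    as a half-open range of naturals inside the scale from [a] to [B * a]. *)
Lemma err_small_interval d : 0 < d <= 1 -> exists B k0, (1 < B)%N /\
  forall a, (k0 <= a)%N -> exists p q, [/\ (a <= p)%N, (q <= B * a)%N,
    (1 + d / 2) * INR p <= INR q &
    forall m, (p <= m < q)%N -> Rabs (err m) <= 2 * d * INR m].
Proof.
move=> d01; have [K [k0 [K0 hp]]] := err_small_point d ltac:(lra).
have [k1 hn] := err_small_near d d01.
exists (2 * K)%N, (maxn (maxn k0 k1) 2); split=> [|a ka]; first by lia.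
have [p /andP[ap pK] ep] := hp a ltac:(lia).
have p0 : (1 < p)%N by lia.
have p2 := INR_leq _ _ p0; rewrite -[INR 2]/2 in p2.
have [q [q1 q2]] := nfloor_ex ((1 + d / 2) * INR p) ltac:(nra).
exists p, q.+1; split=> //.
- suff : (q.+1 <= 2 * p)%N by lia.
  suff : (q < 2 * p)%N by [].
  apply/ltP; apply: INR_lt; rewrite INR_muln -[INR 2]/2; nra.
- by rewrite S_INR; lra.
- move=> m /andP[pm mq]; apply: hn ep _; first by lia.
  by have := INR_leq m q mq; lra.
Qed.

(** [ln n / n] is half of the increment of [ln ^ 2] at [n], up to [/ (2 n)]. *)
Lemma rsum_ln_div_le N : (0 < N)%N ->
  \sum_(1 <= n < N.+1) ln (INR n) / INR n <=
  (ln (INR N) * ln (INR N) + harm N) / 2.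
Proof.
case: N => // N _; elim: N => [|N IH].
  by rewrite rsum_recr // big_geq // harmS harm0 /= ln_1; lra.
rewrite rsum_recr // harmS; have := ln_incr_bounds N.+1 isT.
have := INR_ge1 N.+1 isT; have := INR_ge1 N.+2 isT.
have := ln_INR_ge0 N.+1 isT; have := ln_INR_ge0 N.+2 isT; move: IH.
have : / INR N.+1 <= 1.
  by rewrite -Rinv_1; apply: Rinv_le_contravar; [lra|apply: INR_ge1].
have : 0 < / INR N.+2 by apply: Rinv_0_lt_compat; have := INR_ge1 N.+2 isT; lra.
rewrite /Rdiv; move: (ln (INR N.+2)) (ln (INR N.+1)) (/ INR N.+2) (/ INR N.+1).
move=> b a v u v0 u1 IH b0 a0 _ _ [h1 h2].
have : v * (2 * b - 1) <= (b - a) * (b + a).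
  apply: (Rle_trans _ (v * (b + a))); first by nra.
  by apply: Rmult_le_compat_r; lra.
nra.
Qed.

(** * The error term is negligible *)

(** What the bound [b * k] on [Rabs (err k)] gives away at [k = N %/ n]. *)
Definition gain (b : R) (N n : nat) : R :=
  ln (INR n) * (b * (INR N / INR n) - Rabs (err (N %/ n))).

Lemma gain_ge0 b N N0 n : 0 <= b -> (0 < N0)%N ->
  (forall k, (N0 <= k)%N -> Rabs (err k) <= b * INR k) ->
  (0 < n <= N %/ N0)%N -> 0 <= gain b N n.
Proof.
move=> b0 N00 h /andP[n0 nN]; rewrite /gain.
have := h (N %/ n)%N; rewrite leq_divRL // mulnC -leq_divRL // nN => /(_ isT) e.
have [d1 _] := INR_divn N n n0; have := ln_INR_ge0 _ n0.
by move=> l0; apply: Rmult_le_pos => //; nra.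
Qed.

(** There are at least [N / p * (d / 8)] numbers [n] with [N %/ n] between [p]
    and [q]; each has [ln n] at least [ln N / 2], because [q <= sqrt N], and a
    gain of at least [8 * d * p] times that. The total does not depend on
    [p]. *)
Lemma gain_interval b d N p q : 0 < d <= 1 -> 10 * d <= b -> (0 < p)%N ->
  (1 + d / 2) * INR p <= INR q -> INR q <= sqrt (INR N) ->
  (forall m, (p <= m < q)%N -> Rabs (err m) <= 2 * d * INR m) ->
  8 / d <= sqrt (INR N) ->
  d * d / 2 * INR N * ln (INR N) <=
  \sum_((N %/ q).+1 <= n < (N %/ p).+1) gain b N n.
Proof.
move=> d01 bd p0 pq qN he dN.
have p1 := INR_ge1 _ p0; have q1 : 1 <= INR q by nra.
have q0 : (0 < q)%N by case: q q1 {pq qN he} => //=; lra.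
have s1 : 1 <= sqrt (INR N) by lra.
have N1 : 1 <= INR N.
  by have := sqrt_sqrt (INR N) (pos_INR N); nra.
have N0 : (0 < N)%N by case: N N1 {qN dN s1 he} => //=; lra.
have L0 := ln_INR_ge0 _ N0.
have pleq : (p <= q)%N by apply/leP; apply: INR_le; nra.
have term n : ((N %/ q).+1 <= n < (N %/ p).+1)%N ->
    4 * d * INR p * ln (INR N) <= gain b N n.
  rewrite ltnS => /andP[nq np].
  have n0 := leq_ltn_trans (leq0n _) nq.
  have n1 := INR_ge1 _ n0.
  have in_pq : (p <= N %/ n < q)%N.
    rewrite leq_divRL // mulnC -leq_divRL // np /=.
    by rewrite ltn_divLR // mulnC -ltn_divLR.
  have e := he _ in_pq; have [d1 _] := INR_divn N n n0.
  have nN : INR p <= INR N / INR n.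
    by apply: Rle_trans d1; apply: INR_leq; case/andP: in_pq.
  have ns : sqrt (INR N) <= INR n.
    have [_ h] := INR_divn N q q0; have := INR_leq _ _ nq; rewrite S_INR => h'.
    have : INR N <= INR n * INR q.
      have -> : INR N = INR N / INR q * INR q by field; lra.
      by apply: Rmult_le_compat_r; lra.
    have := sqrt_sqrt (INR N) (pos_INR N) => ss h2.
    by apply: (Rmult_le_reg_r (sqrt (INR N))); nra.
  have ll : ln (INR N) / 2 <= ln (INR n).
    have : ln (sqrt (INR N)) <= ln (INR n) by apply: ln_le; lra.
    have -> : ln (INR N) = ln (sqrt (INR N)) + ln (sqrt (INR N)).
      by rewrite -ln_mult ?sqrt_sqrt; lra.
    lra.
  have g1 : 8 * d * INR p <= b * (INR N / INR n) - Rabs (err (N %/ n)).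
    have : 10 * d * (INR N / INR n) <= b * (INR N / INR n).
      by apply: Rmult_le_compat_r; lra.
    have : 2 * d * INR (N %/ n) <= 2 * d * (INR N / INR n).
      by apply: Rmult_le_compat_l; lra.
    have : 8 * d * INR p <= 8 * d * (INR N / INR n).
      by apply: Rmult_le_compat_l; lra.
    lra.
  have dp : 0 <= 8 * d * INR p by nra.
  rewrite /gain; apply: (Rle_trans _ (ln (INR N) / 2 * (8 * d * INR p))); first lra.
  by apply: Rmult_le_compat; lra.
have := ler_rsum _ _ (fun=> 4 * d * INR p * ln (INR N)) _ term.
rewrite rsum_const_ge; last by rewrite ltnS; apply: leq_div2l.
apply: Rle_trans; rewrite !S_INR.
have [_ hp] := INR_divn N p p0; have [hq _] := INR_divn N q q0.
have x1 : sqrt (INR N) <= INR N / INR p.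
  apply: (Rmult_le_reg_r (INR p)); first lra.
  have -> : INR N / INR p * INR p = sqrt (INR N) * sqrt (INR N).
    by rewrite sqrt_sqrt; [field|]; lra.
  by apply: Rmult_le_compat_l; nra.
have hq' : INR N / INR q <= INR N / INR p * (1 - d / 4).
  apply: (Rmult_le_reg_r (INR q)); first lra.
  have -> : INR N / INR q * INR q = INR N / INR p * INR p by field; lra.
  have -> : INR N / INR p * (1 - d / 4) * INR q =
    INR N / INR p * ((1 - d / 4) * INR q) by ring.
  apply: Rmult_le_compat_l; first lra.
  apply: (Rle_trans _ ((1 - d / 4) * ((1 + d / 2) * INR p))).
    have -> : (1 - d / 4) * ((1 + d / 2) * INR p) =
      INR p + INR p * (d / 4 - d * d / 8) by field.
    have h : 0 <= d / 4 - d * d / 8 by nra.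
    by have := Rmult_le_pos _ _ (pos_INR p) h; lra.
  by apply: Rmult_le_compat_l; lra.
have cnt : INR N / INR p * (d / 8) <= INR (N %/ p) + 1 - (INR (N %/ q) + 1).
  have : 1 <= INR N / INR p * (d / 8).
    have -> : 1 = 8 / d * (d / 8) by field; lra.
    by apply: Rmult_le_compat_r; lra.
  lra.
apply: (Rle_trans _ (INR N / INR p * (d / 8) * (4 * d * INR p * ln (INR N)))).
  by right; field; lra.
apply: Rmult_le_compat_r => //.
by apply: Rmult_le_pos => //; nra.
Qed.

Lemma range_widen a n b c : (a < n < b.+1)%N -> (b <= c)%N -> (0 < n <= c)%N.
Proof. lia. Qed.

(** Every scale from [B ^ j] to [B ^ j.+1] contains an interval to which
    [gain_interval] applies, and distinct scales involve distinct [n]. *)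
Lemma gain_blocks b d N B k0 N0 j0 J :
  0 < d <= 1 -> 10 * d <= b -> (1 < B)%N -> (0 < N0)%N ->
  (forall a, (k0 <= a)%N -> exists p q, [/\ (a <= p)%N, (q <= B * a)%N,
    (1 + d / 2) * INR p <= INR q &
    forall m, (p <= m < q)%N -> Rabs (err m) <= 2 * d * INR m]) ->
  (forall k, (N0 <= k)%N -> Rabs (err k) <= b * INR k) ->
  (k0 <= B ^ j0)%N -> (N0 <= B ^ j0)%N -> (j0 <= J)%N ->
  INR (B ^ J) <= sqrt (INR N) -> 8 / d <= sqrt (INR N) ->
  (INR J - INR j0) * (d * d / 2 * INR N * ln (INR N)) <=
  \sum_((N %/ B ^ J).+1 <= n < (N %/ B ^ j0).+1) gain b N n.
Proof.
move=> d01 bd B1 N00 hB hN kj Nj; elim: J => [|J IH].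
  rewrite leqn0 => /eqP -> _ _; rewrite big_geq //; lra.
rewrite leq_eqVlt => /orP[/eqP -> _ _|]; first by rewrite big_geq //; lra.
rewrite ltnS => jJ BN dN.
have BJ : (0 < B ^ J)%N by rewrite expn_gt0; lia.
have BJ1 := INR_ge1 _ BJ.
have BS : (B ^ J <= B ^ J.+1)%N by rewrite leq_exp2l.
have BjJ : (B ^ j0 <= B ^ J)%N by rewrite leq_exp2l.
have [|p [q [ap qB pq he]]] := hB (B ^ J)%N; first by apply: leq_trans BjJ.
have qB' : (q <= B ^ J.+1)%N by rewrite expnS.
have p0 : (0 < p)%N by lia.
have p1 := INR_ge1 _ p0.
have q0 : (0 < q)%N by apply/ltP; apply: INR_lt => /=; nra.
have pleq : (p <= q)%N by apply/leP; apply: INR_le; nra.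
have G := gain_interval b d N p q d01 bd p0 pq
  (Rle_trans _ _ _ (INR_leq _ _ qB') BN) he dN.
have {}IH := IH jJ (Rle_trans _ _ _ (INR_leq _ _ BS) BN) dN.
have g0 n : (0 < n <= N %/ B ^ j0)%N -> 0 <= gain b N n.
  move=> /andP[n0 nN]; apply: (gain_ge0 b N N0) => //; first lra.
  by rewrite n0; apply: leq_trans nN _; apply: leq_div2l.
have h1 : (N %/ B ^ J.+1 <= N %/ q)%N by apply: leq_div2l.
have h2 : (N %/ q <= N %/ p)%N by apply: leq_div2l.
have h3 : (N %/ p <= N %/ B ^ J)%N by apply: leq_div2l => //; lia.
have h4 : (N %/ B ^ J <= N %/ B ^ j0)%N by apply: leq_div2l => //; lia.
rewrite (rsum_cat _ (N %/ q).+1) ?ltnS //; last lia.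
rewrite (rsum_cat (N %/ q).+1 (N %/ p).+1) ?ltnS //; last lia.
rewrite (rsum_cat (N %/ p).+1 (N %/ B ^ J).+1) ?ltnS //.
have r1 : 0 <= \sum_((N %/ B ^ J.+1).+1 <= n < (N %/ q).+1) gain b N n.
  by apply: rsum_ge0 => n hn;
    apply/g0/(range_widen _ _ _ _ hn)/(leq_trans h2)/(leq_trans h3).
have r2 : 0 <= \sum_((N %/ p).+1 <= n < (N %/ B ^ J).+1) gain b N n.
  by apply: rsum_ge0 => n hn; apply/g0/(range_widen _ _ _ _ hn).
by rewrite S_INR; lra.
Qed.

Definition err_eventually_le (b : R) :=
  exists N0, forall n, (N0 <= n)%N -> Rabs (err n) <= b * INR n.

(** In [err_ln_sqr_le] the bound [b] on [err] would only give back [b] itself.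
    The gains at the [ln N / (2 ln B)] scales below [sqrt N] add up to a fixed
    proportion of [N * ln N ^ 2], which lowers [b] by a fixed amount [c]; [c]
    depends on [d] alone, through [B]. *)
Lemma err_improve d : 0 < d <= 1 -> exists2 c, 0 < c &
  forall b, 10 * d <= b -> err_eventually_le b -> err_eventually_le (b - c).
Proof.
move=> d01; have [B [k0 [B1 hB]]] := err_small_interval d d01.
have B2 := INR_leq _ _ B1; rewrite -[INR 2]/2 in B2.
have lB : 0 < ln (INR B) by rewrite -ln_1; apply: ln_increasing; lra.
exists (d * d / (8 * ln (INR B))).
  by apply: Rdiv_lt_0_compat; nra.
move=> b bd [N1 hN1]; set c := d * d / _.
have c0 : 0 < c by apply: Rdiv_lt_0_compat; nra.
pose N0 := (maxn N1 1).
have hN k : (N0 <= k)%N -> Rabs (err k) <= b * INR k by move=> h; apply: hN1; lia.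
have N00 : (0 < N0)%N by lia.
pose j0 := maxn k0 N0.
have jB : (j0 <= B ^ j0)%N by apply: ltnW; apply: ltn_expl.
pose C := 2 * b + 440 + 20 * INR N0.
(* [n1] makes at least half of the scales lie above [j0], [n2] absorbs the
   terms of order [N * ln N], and [n3] makes the intervals of each scale long
   enough. *)
have [n1 n10 h1] := ln_ge_eventually (4 * ln (INR B) * (INR j0 + 1)).
have [n2 n20 h2] := ln_ge_eventually (2 * C / c + 1).
have [n3 h3] := INR_above ((8 / d) * (8 / d)).
exists (maxn n1 (maxn n2 n3)) => N hNn.
have N_0 : (0 < N)%N by lia.
have NR1 := INR_ge1 _ N_0; have L0 := ln_INR_ge0 _ N_0.
have {}h1 := h1 N ltac:(lia); have {}h2 := h2 N ltac:(lia).
have {}h3 : 8 / d <= sqrt (INR N).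
  have E : 0 < 8 / d by apply: Rdiv_lt_0_compat; lra.
  rewrite -(sqrt_square (8 / d)); last lra.
  by apply: sqrt_le_1_alt; have := INR_leq n3 N ltac:(lia); lra.
have N0R := INR_ge1 _ N00.
have C0 : 0 < C by rewrite /C; lra.
have L1 : 1 <= ln (INR N).
  have : 0 < 2 * C / c by apply: Rdiv_lt_0_compat; lra.
  lra.
set L := ln (INR N) in L0 L1 h1 h2 *.
have [J [J1 J2]] := nfloor_ex (L / (2 * ln (INR B)))
  ltac:(apply: Rlt_le; apply: Rdiv_lt_0_compat; lra).
have LB : L = L / (2 * ln (INR B)) * (2 * ln (INR B)) by field; lra.
have BJ : INR (B ^ J) <= sqrt (INR N).
  have BJ0 : (0 < B ^ J)%N by rewrite expn_gt0; lia.
  have BJ1 := INR_ge1 _ BJ0.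
  have lBJ : ln (INR (B ^ J)) = INR J * ln (INR B).
    elim: (J) => [|k IH]; first by rewrite /= ln_1; ring.
    by rewrite expnS INR_muln ln_mult ?IH ?S_INR; [ring | lra |
       have := INR_ge1 (B ^ k); rewrite expn_gt0 ltnW // => /(_ isT); lra].
  have h : 2 * ln (INR (B ^ J)) <= L.
    have : INR J * (2 * ln (INR B)) <= L / (2 * ln (INR B)) * (2 * ln (INR B)).
      by apply: Rmult_le_compat_r; lra.
    by rewrite lBJ -LB; lra.
  rewrite -(sqrt_square (INR (B ^ J))); last lra.
  apply: sqrt_le_1_alt; apply: Rnot_lt_le => lt.
  have := ln_increasing (INR N) _ ltac:(lra) lt; rewrite ln_mult -/L; lra.
have Jj : L / (4 * ln (INR B)) <= INR J - INR j0.
  have LB4 : L / (4 * ln (INR B)) = L / (2 * ln (INR B)) / 2 by field; lra.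
  have : INR j0 + 1 <= L / (4 * ln (INR B)).
    apply: (Rmult_le_reg_r (4 * ln (INR B))); first lra.
    have -> : L / (4 * ln (INR B)) * (4 * ln (INR B)) = L by field; lra.
    lra.
  lra.
have jJ : (j0 <= J)%N.
  apply/leP; apply: INR_le.
  have : 0 < L / (4 * ln (INR B)) by apply: Rdiv_lt_0_compat; lra.
  lra.
have kB := leq_trans (leq_maxl _ _ : (k0 <= j0)%N) jB.
have NB := leq_trans (leq_maxr _ _ : (N0 <= j0)%N) jB.
have G := gain_blocks b d N B k0 N0 j0 J d01 bd B1 N00 hB hN kB NB jJ BJ h3.
rewrite -/L in G.
have g0 n : (0 < n <= N %/ N0)%N -> 0 <= gain b N n.
  by apply: gain_ge0 => //; lra.
have gain_all : c * (INR N * (L * L)) <= \sum_(1 <= n < (N %/ N0).+1) gain b N n.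
  have i1 : (N %/ B ^ J <= N %/ B ^ j0)%N.
    by apply: leq_div2l; [rewrite expn_gt0; lia | rewrite leq_exp2l].
  have i2 : (N %/ B ^ j0 <= N %/ N0)%N by apply: leq_div2l => //; lia.
  rewrite (rsum_cat 1 (N %/ B ^ J).+1) ?ltnS //; last lia.
  rewrite (rsum_cat (N %/ B ^ J).+1 (N %/ B ^ j0).+1) ?ltnS //.
  have r1 : 0 <= \sum_(1 <= n < (N %/ B ^ J).+1) gain b N n.
    by apply: rsum_ge0 => n hn; apply/g0/(range_widen _ _ _ _ hn)/(leq_trans i1).
  have r2 : 0 <= \sum_((N %/ B ^ j0).+1 <= n < (N %/ N0).+1) gain b N n.
    by apply: rsum_ge0 => n hn; apply/g0/(range_widen _ _ _ _ hn).
  have : L / (4 * ln (INR B)) * (d * d / 2 * INR N * L) <=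
         (INR J - INR j0) * (d * d / 2 * INR N * L).
    apply: Rmult_le_compat_r => //.
    apply: Rmult_le_pos => //; apply: Rmult_le_pos; nra.
  have -> : L / (4 * ln (INR B)) * (d * d / 2 * INR N * L) = c * (INR N * (L * L)).
    by rewrite /c; field; lra.
  lra.
have main := err_ln_sqr_le N N_0; rewrite -/L in main.
have split_sum : \sum_(1 <= n < N.+1) ln (INR n) * Rabs (err (N %/ n)) <=
   b * INR N * ((L * L + (1 + L)) / 2) - c * (INR N * (L * L))
   + 10 * INR N0 * (INR N * L).
  have i0 : (N %/ N0 <= N)%N by rewrite leq_div.
  rewrite (rsum_cat 1 (N %/ N0).+1 N.+1) ?ltnS //.
  have -> : \sum_(1 <= n < (N %/ N0).+1) ln (INR n) * Rabs (err (N %/ n)) =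
    b * INR N * \sum_(1 <= n < (N %/ N0).+1) ln (INR n) / INR n
    - \sum_(1 <= n < (N %/ N0).+1) gain b N n.
    rewrite -rsumZ -rsumB big_nat [RHS]big_nat; apply: eq_bigr => n /andP[n0 _].
    by rewrite /gain; field; have := INR_ge1 _ n0; lra.
  have t1 : \sum_(1 <= n < (N %/ N0).+1) ln (INR n) / INR n <=
            (L * L + (1 + L)) / 2.
    apply: (Rle_trans _ (\sum_(1 <= n < N.+1) ln (INR n) / INR n)).
      rewrite (rsum_cat 1 (N %/ N0).+1 N.+1) ?ltnS //.
      have : 0 <= \sum_((N %/ N0).+1 <= n < N.+1) ln (INR n) / INR n; last lra.
      apply: rsum_ge0 => n /andP[n0 _]; have n0' := leq_ltn_trans (leq0n _) n0.
      have := ln_INR_ge0 _ n0'; have : 0 < / INR n; last by rewrite /Rdiv; nra.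
      by apply: Rinv_0_lt_compat; have := INR_ge1 _ n0'; lra.
    by have := rsum_ln_div_le N N_0; have := harm_le N N_0; rewrite -/L; lra.
  have t2 : \sum_((N %/ N0).+1 <= n < N.+1) ln (INR n) * Rabs (err (N %/ n)) <=
      10 * INR N0 * (INR N * L).
    apply: (Rle_trans _ (\sum_((N %/ N0).+1 <= n < N.+1) L * (10 * INR N0))).
      apply: ler_rsum => n /andP[nn0 nN]; have n0 := leq_ltn_trans (leq0n _) nn0.
      apply: Rmult_le_compat; [exact: ln_INR_ge0 | exact: Rabs_pos | |].
        by apply: ln_le; [have := INR_ge1 _ n0; lra | apply: INR_leq].
      apply: Rle_trans (err_abs_le _) _; apply: Rmult_le_compat_l; first lra.
      by apply: INR_leq; apply: ltnW; rewrite ltn_divLR // mulnC -ltn_divLR.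
    rewrite rsum_const_ge ?ltnS //.
    rewrite !S_INR; have := pos_INR (N %/ N0) => h.
    have : (INR N + 1 - (INR (N %/ N0) + 1)) * (L * (10 * INR N0)) <=
      INR N * (L * (10 * INR N0)) by apply: Rmult_le_compat_r; nra.
    lra.
  have : b * INR N * \sum_(1 <= n < (N %/ N0).+1) ln (INR n) / INR n <=
    b * INR N * ((L * L + (1 + L)) / 2) by apply: Rmult_le_compat_l; nra.
  lra.
have LL : C * (2 * L) <= c * (L * L).
  have : 2 * C <= c * L.
    have -> : 2 * C = c * (2 * C / c) by field; lra.
    by apply: Rmult_le_compat_l; lra.
  by nra.
apply: (Rmult_le_reg_r (L * L)); first by nra.
have : INR N * (C * (2 * L)) <= INR N * (c * (L * L)) by apply: Rmult_le_compat_l; lra.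
have : INR N * (b + 440) * 1 <= INR N * (b + 440) * L.
  by apply: Rmult_le_compat_l; nra.
have : 0 <= b * (INR N * L) by apply: Rmult_le_pos; nra.
have : 0 <= INR N0 * (INR N * L) by apply: Rmult_le_pos; nra.
rewrite /C in C0 *; nra.
Qed.

(** Let [a] be the infimum of the eventual bounds. If [a] were positive,
    [err_improve] with [10 * d = a] would turn a bound between [a] and [a + c]
    into a bound below [a]. *)
Lemma err_little_o e : 0 < e -> err_eventually_le e.
Proof.
move=> e0.
pose E x := forall b, err_eventually_le b -> x <= b.
have Q10 : err_eventually_le 10 by exists 0%N => n _; apply: err_abs_le.
have E0 : E 0.
  move=> b [N0 /(_ N0.+1 (leqnSn _)) h]; have := Rabs_pos (err N0.+1).
  by have := INR_ge1 N0.+1 isT; nra.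
have Eb : bound E by exists 10 => x; apply.
have [a [aub alub]] := completeness E Eb (ex_intro _ 0 E0).
have lb b : err_eventually_le b -> a <= b by move=> Qb; apply: alub => x; apply.
have below x : a < x -> exists2 b, err_eventually_le b & b < x.
  move=> ax; have [//|no] := Classical_Prop.classic (exists2 b, err_eventually_le b & b < x).
  have : E x by move=> b Qb; apply: Rnot_lt_le => bx; apply: no; exists b.
  by move=> /aub; lra.
have a0 : 0 <= a by apply: aub.
have [apos|a_0] := Rle_lt_or_eq_dec _ _ a0; last first.
  have [b [N0 hb] be] := below e ltac:(lra).
  exists N0 => n /hb h; apply: Rle_trans h _; apply: Rmult_le_compat_r; [exact: pos_INR|lra].
have a10 := lb _ Q10.
have [c c0 hc] := err_improve (a / 10) ltac:(lra).
have [b Qb bc] := below (a + c) ltac:(lra).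
by have := lb _ (hc b ltac:(have := lb _ Qb; lra) Qb); lra.
Qed.

(** * From psi to pi, and the logarithmic integral *)

Definition pi_nat (N : nat) : R := \sum_(1 <= n < N.+1) (if prime n then 1 else 0).

Lemma prime_pi_floor x N : INR N <= x < INR N + 1 -> INR (prime_pi x) = pi_nat N.
Proof.
move=> hN; rewrite /prime_pi /primes_le.
have <- : Z.of_nat N.+1 = up x.
  by apply: tech_up; rewrite -INR_IZR_INZ S_INR; lra.
rewrite Nat2Z.id {hN}; elim: N => [|N IH]; first by rewrite /pi_nat big_geq.
rewrite /pi_nat rsum_recr // -/(pi_nat N) -IH -[in LHS]addn1 iotaD filter_cat size_cat.
by rewrite INR_addn add0n /=; case: prime.
Qed.

Definition prime_pow_of (p n : nat) : bool := (p %| n) && (n == p ^ logn p n)%N.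

Lemma prime_pow_of_mul p m : prime p -> (0 < m)%N ->
  prime_pow_of p (p * m) -> m = 1%N \/ prime_pow_of p m.
Proof.
move=> pp m0; have p0 := prime_gt0 pp; rewrite /prime_pow_of => /andP[_].
rewrite lognM // logn_prime // eqxx expnD expn1 eqn_pmul2l // => /eqP mE.
have [l0|l0] := posnP (logn p m); first by left; rewrite mE l0.
by right; rewrite -mE eqxx andbT; move: l0; rewrite logn_gt0 mem_primes => /and3P[].
Qed.

(** The powers of [p] up to [N], divided by [p], are [1] and the powers of [p]
    up to [N %/ p]: induction on [N]. *)
Lemma rsum_prime_pow_le p N : prime p -> (0 < N)%N ->
  \sum_(1 <= n < N.+1) (if prime_pow_of p n then ln (INR p) else 0) <= ln (INR N).
Proof.
move=> pp; have p0 := prime_gt0 pp; have p1 := prime_gt1 pp.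
have lp := ln_prime_gt0 p pp.
elim/ltn_ind: N => N IH N0.
have -> : \sum_(1 <= n < N.+1) (if prime_pow_of p n then ln (INR p) else 0) =
  \sum_(1 <= n < N.+1 | p %| n) (if prime_pow_of p n then ln (INR p) else 0).
  rewrite [RHS]rsum_mkcond; apply: eq_bigr => n _.
  by rewrite /prime_pow_of; case: ifP => //; case: (p %| n).
rewrite rsum_multiples //.
have [->|M0] := posnP (N %/ p); first by rewrite big_geq //; apply: ln_INR_ge0.
have {}IH := IH (N %/ p)%N (ltn_Pdiv p1 N0) M0.
apply: (Rle_trans _ (ln (INR p) + ln (INR (N %/ p)))); last first.
  rewrite -ln_mult; [|have := INR_ge1 _ p0; lra|have := INR_ge1 _ M0; lra].
  have := INR_ge1 _ p0; have := INR_ge1 _ M0 => h1 h2.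
  apply: ln_le; first by nra.
  by rewrite -INR_muln; apply: INR_leq; rewrite mulnC leq_trunc_div.
apply: (Rle_trans _ (\sum_(1 <= m < (N %/ p).+1) (if m == 1%N then ln (INR p) else 0) +
   \sum_(1 <= m < (N %/ p).+1) (if prime_pow_of p m then ln (INR p) else 0))); last first.
  by rewrite rsum_delta //; lra.
rewrite -rsumD; apply: ler_rsum => m /andP[m0 _].
have T1 : 0 <= (if m == 1%N then ln (INR p) else 0) by case: ifP => _; lra.
have T2 : 0 <= (if prime_pow_of p m then ln (INR p) else 0) by case: ifP => _; lra.
case: ifP => [/(prime_pow_of_mul p m pp m0)|_]; last lra.
by case=> [m1|pm]; [rewrite m1 /= in T2 * | rewrite pm in T2 *]; lra.
Qed.

(** [psi N] counts each prime [p] with the weight [ln p] as often as it has a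
    power up to [N]. *)
Lemma psi_le_pi_ln N : (0 < N)%N -> psi N <= pi_nat N * ln (INR N).
Proof.
move=> N0.
apply: (Rle_trans _ (\sum_(1 <= n < N.+1) \sum_(1 <= p < N.+1)
   (if prime p then (if prime_pow_of p n then ln (INR p) else 0) else 0))).
  apply: ler_rsum => n /andP[n0 nN].
  have T p : 0 <= if prime p then (if prime_pow_of p n then ln (INR p) else 0) else 0.
    case: ifP => [/ln_prime_gt0 h|_]; last lra.
    by case: ifP => _; lra.
  case: (Req_dec (mangoldt n) 0) => [->|/mangoldt_neq0 [p [k [pp k0 nE]]]].
    by apply: rsum_ge0.
  have pn : (0 < p <= N)%N.
    rewrite prime_gt0 //=; apply: leq_trans (_ : n <= N)%N => //.
    by rewrite nE -{1}(expn1 p) leq_exp2l // prime_gt1.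
  have -> : mangoldt n = ln (INR p) by rewrite nE; case: (k) k0 => // j _; apply: mangoldt_pX.
  rewrite -(rsum_delta N p (ln (INR p)) pn); apply: ler_rsum => q _.
  case: eqP => [->|_]; last exact: T.
  rewrite pp /prime_pow_of nE pfactorK // eqxx dvdn_exp //; exact: Rle_refl.
rewrite exchange_big_nat /= Rmult_comm /pi_nat -rsumZ.
apply: ler_rsum => p /andP[p0 _]; case: ifP => [pp|_].
  by rewrite Rmult_1_r; apply: rsum_prime_pow_le.
by rewrite big1 // Rmult_0_r; lra.
Qed.

Lemma mangoldt_prime p : prime p -> mangoldt p = ln (INR p).
Proof. by move=> pp; rewrite -(mangoldt_pX p 0) // expn1. Qed.

(** The primes between [M] and [N] have logarithm at least [ln M], and there
    are at most [M] others. *)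
Lemma pi_ln_le_psi M N : (0 < M <= N)%N ->
  (pi_nat N - INR M) * ln (INR M) <= psi N.
Proof.
move=> /andP[M0 MN]; have M1 := INR_ge1 _ M0; have L0 := ln_INR_ge0 _ M0.
have pM : pi_nat M <= INR M.
  rewrite -(Rmult_1_r (INR M)) -rsum_const; apply: ler_rsum => n _.
  by case: ifP => _; lra.
have : (\sum_(M.+1 <= n < N.+1) (if prime n then 1 else 0)) * ln (INR M) <= psi N.
  apply: (Rle_trans _ (\sum_(M.+1 <= n < N.+1) mangoldt n)); last first.
    by rewrite /psi (rsum_cat 1 M.+1 N.+1) //; have := psi_ge0 M; rewrite /psi; lra.
  rewrite Rmult_comm -rsumZ; apply: ler_rsum => n /andP[nM _].
  case: ifP => [np|_]; last by have := mangoldt_ge0 n; lra.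
  by rewrite mangoldt_prime // Rmult_1_r; apply: ln_le; [lra|apply: INR_leq; apply: ltnW].
have : pi_nat N = pi_nat M + \sum_(M.+1 <= n < N.+1) (if prime n then 1 else 0).
  by rewrite /pi_nat (rsum_cat 1 M.+1 N.+1).
nra.
Qed.

(** [exp ((1 - e) * ln x)] is [x] to the power [1 - e]; cutting there loses
    little, since its logarithm is still close to that of [x]. *)
Lemma power_cut e : 0 < e < 1 -> exists x0, 1 < x0 /\ forall x, x0 <= x ->
  [/\ exp ((1 - e) * ln x) * ln x <= e * x, ln x <= e * x & 2 <= e * x].
Proof.
move=> e01; set A := 4 / (e * e * e).
have ee : 0 < e * e by nra.
have eee : 0 < e * e * e by nra.
have A0 : 0 < A by apply: Rdiv_lt_0_compat; lra.
have AE : A * (e * e * e) = 4.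
  by rewrite /A; field; lra.
exists (exp (A + 1) + 2 / e + 1); have E0 := exp_pos (A + 1).
have e2 : 0 < 2 / e by apply: Rdiv_lt_0_compat; lra.
split; first lra.
move=> x hx; have x0 : 0 < x by lra.
have L : A <= ln x.
  have : ln (exp (A + 1)) <= ln x by apply: ln_le; lra.
  by rewrite ln_exp; lra.
have L0 : 0 < ln x by lra.
have ex2 : 2 <= e * x.
  have -> : 2 = e * (2 / e) by field; lra.
  by apply: Rmult_le_compat_l; lra.
have xE : x = exp ((1 - e) * ln x) * exp (e * ln x).
  rewrite -exp_plus; have -> : (1 - e) * ln x + e * ln x = ln x by ring.
  by rewrite exp_ln.
have quad t : 0 <= t -> t * t / 4 <= exp t.
  move=> t0; have h := exp_ineq1_le (t / 2).
  have -> : exp t = exp (t / 2) * exp (t / 2) by rewrite -exp_plus; congr exp; field.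
  have : (1 + t / 2) * (1 + t / 2) <= exp (t / 2) * exp (t / 2).
    by apply: Rmult_le_compat; lra.
  nra.
have y0 := exp_pos ((1 - e) * ln x).
have key : ln x <= e * exp (e * ln x).
  have h := quad (e * ln x) ltac:(nra).
  have : ln x * 4 <= ln x * (ln x * (e * e * e)).
    apply: Rmult_le_compat_l; first lra.
    by rewrite -AE; apply: Rmult_le_compat_r; lra.
  have : e * (e * ln x * (e * ln x) / 4) <= e * exp (e * ln x).
    by apply: Rmult_le_compat_l; lra.
  lra.
have cut : exp ((1 - e) * ln x) * ln x <= e * x.
  have -> : e * x = exp ((1 - e) * ln x) * (e * exp (e * ln x)).
    by rewrite {1}xE; ring.
  exact: (Rmult_le_compat_l _ _ _ (Rlt_le _ _ y0) key).
split=> //.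
have : 1 <= exp ((1 - e) * ln x).
  have := exp_ineq1_le ((1 - e) * ln x).
  by have := Rmult_lt_0_compat (1 - e) (ln x) ltac:(lra) L0; lra.
nra.
Qed.

(** The factor 10 leaves room for the accumulated losses of a few [e]. *)
Lemma is_lim_1_of_bounds (f : R -> R) :
  (forall e, 0 < e <= / 4 -> exists x0, forall x, x0 <= x ->
     1 - 10 * e <= f x <= 1 + 10 * e) ->
  is_lim f p_infty 1.
Proof.
move=> h; apply/is_lim_spec => eps.
have e0 : 0 < Rmin (/ 4) (eps / 20).
  by apply: Rmin_glb_lt; [lra|have := cond_pos eps; lra].
have e1 := Rmin_l (/ 4) (eps / 20); have e2 := Rmin_r (/ 4) (eps / 20).
have [x0 hx] := h (Rmin (/ 4) (eps / 20)) ltac:(lra).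
exists x0 => x xx; have := hx x ltac:(lra); have := cond_pos eps.
by move=> ? ?; apply: Rabs_def1; lra.
Qed.

(** The lower bound is [psi_le_pi_ln]; the upper bound is [pi_ln_le_psi] with
    [M] just above [y = x ^ (1 - e)], as [ln M] is then almost [ln x]. *)
Lemma is_lim_prime_pi :
  is_lim (fun x => INR (prime_pi x) * ln x / x) p_infty 1.
Proof.
apply: is_lim_1_of_bounds => e e01.
have [x0 [x01 cut]] := power_cut e ltac:(lra).
have [N0 hN0] := err_little_o e ltac:(lra).
exists (Rmax x0 (INR N0 + 1)) => x hx.
have h1 := Rmax_l x0 (INR N0 + 1); have h2 := Rmax_r x0 (INR N0 + 1).
have [c1 c2 c3] := cut x ltac:(lra).
have [N [n1 n2]] := nfloor_ex x ltac:(lra).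
rewrite (prime_pi_floor x N); last lra.
have NN : (N0 <= N)%N by apply/leP; apply: INR_le; lra.
have N1 : (0 < N)%N by apply/ltP; apply: INR_lt => /=; lra.
have NR := INR_ge1 _ N1.
have L0 : 0 < ln x by rewrite -ln_1; apply: ln_increasing; lra.
have /Rabs_le_between := hN0 N NN; rewrite /err => E.
have P0 : 0 <= pi_nat N by apply: rsum_ge0 => n _; case: ifP => _; lra.
have low : (1 - 10 * e) * x <= pi_nat N * ln x.
  have := psi_le_pi_ln N N1.
  have : pi_nat N * ln (INR N) <= pi_nat N * ln x.
    by apply: Rmult_le_compat_l => //; apply: ln_le; lra.
  have : e * INR N <= e * x by apply: Rmult_le_compat_l; lra.
  lra.
have high : pi_nat N * ln x <= (1 + 10 * e) * x.
  set y := exp ((1 - e) * ln x) in c1.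
  have y0 : 0 < y by apply: exp_pos.
  have [M [m1 m2]] := nfloor_ex y ltac:(lra).
  have lM : (1 - e) * ln x <= ln (INR M.+1).
    by rewrite -(ln_exp ((1 - e) * ln x)) S_INR -/y; apply: ln_le; lra.
  have lM0 : 0 <= (1 - e) * ln x by apply: Rmult_le_pos; lra.
  have [MN|NM] := leqP M.+1 N; last first.
    have : pi_nat N <= y + 1.
      apply: (Rle_trans _ (INR N)).
        rewrite -(Rmult_1_r (INR N)) -rsum_const; apply: ler_rsum => n _.
        by case: ifP => _; lra.
      have := INR_leq N M.+1 (ltnW NM); rewrite S_INR; lra.
    by move=> h; have := Rmult_le_compat_r (ln x) _ _ ltac:(lra) h; lra.
  have h := pi_ln_le_psi M.+1 N MN.
  have psiN : psi N <= (1 + e) * x.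
    by apply: (Rle_trans _ ((1 + e) * INR N)); [|apply: Rmult_le_compat_l]; lra.
  have : (pi_nat N - INR M.+1) * ((1 - e) * ln x) <= (1 + e) * x.
    have [neg|pos] := Rle_lt_dec (pi_nat N - INR M.+1) 0; first by nra.
    by apply: Rle_trans psiN; apply: Rle_trans h; apply: Rmult_le_compat_l; lra.
  rewrite S_INR => h3.
  have : INR M * ln x <= e * x.
    by apply: Rle_trans c1; apply: Rmult_le_compat_r; lra.
  have M0 := pos_INR M => h4.
  have : (1 - e) * (pi_nat N * ln x) <= (1 + 3 * e) * x.
    have Mln : 0 <= INR M * ln x by apply: Rmult_le_pos; lra.
    have : 0 <= e * (INR M * ln x + ln x) by apply: Rmult_le_pos; lra.
    lra.
  move=> h5; apply: (Rmult_le_reg_l (1 - e)); first lra.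
  apply: Rle_trans h5 _; rewrite -Rmult_assoc.
  apply: Rmult_le_compat_r; first lra.
  by have := Rmult_le_compat_l e e (/ 4) ltac:(lra) ltac:(lra); lra.
have X : pi_nat N * ln x / x * x = pi_nat N * ln x by field; lra.
by split; apply: (Rmult_le_reg_r x); lra.
Qed.

Lemma ex_RInt_inv_ln a b : 1 < a -> a <= b -> ex_RInt (fun t => / ln t) a b.
Proof.
move=> a1 ab; apply: ex_RInt_continuous => t; rewrite Rmin_left // Rmax_right //.
by move=> h; apply: continuous_inv_ln; lra.
Qed.

Lemma RInt_inv_ln_bounds a b : 1 < a -> a <= b ->
  (b - a) / ln b <= RInt (fun t => / ln t) a b <= (b - a) / ln a.
Proof.
move=> a1 ab.
have la : 0 < ln a by rewrite -ln_1; apply: ln_increasing; lra.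
have E c : (b - a) / c = RInt (fun=> / c) a b by rewrite RInt_const.
rewrite !E; split; apply: RInt_le => //; try exact: ex_RInt_const;
  try exact: ex_RInt_inv_ln.
- move=> t ht; apply: Rinv_le_contravar; last by apply: ln_le; lra.
  by rewrite -ln_1; apply: ln_increasing; lra.
- move=> t ht; apply: Rinv_le_contravar => //; apply: ln_le; lra.
Qed.

(** The same cut at [y]: the integrand is at most [/ ln y] beyond [y], and the
    part before [y] is negligible. *)
Lemma is_lim_Li : is_lim (fun x => Li x * ln x / x) p_infty 1.
Proof.
apply: is_lim_1_of_bounds => e e01.
have [x0 [x01 cut]] := power_cut e ltac:(lra).
exists (Rmax x0 (Rmax 16 (exp 4))) => x hx.
have h1 := Rmax_l x0 (Rmax 16 (exp 4)); have h2 := Rmax_r x0 (Rmax 16 (exp 4)).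
have h3 := Rmax_l 16 (exp 4); have h4 := Rmax_r 16 (exp 4).
have [c1 c2 c3] := cut x ltac:(lra).
have L4 : 4 <= ln x by rewrite -(ln_exp 4); apply: ln_le; [apply: exp_pos|lra].
set y := exp ((1 - e) * ln x) in c1.
have y2 : 2 <= y.
  by have := exp_ineq1_le ((1 - e) * ln x); rewrite -/y; nra.
have yx : y <= x by nra.
have ly : ln y = (1 - e) * ln x by rewrite ln_exp.
have l2 := ln_lt_2.
have LiE : Li x = RInt (fun t => / ln t) 2 y + RInt (fun t => / ln t) y x.
  by rewrite /Li -(RInt_Chasles _ 2 y x) //; apply: ex_RInt_inv_ln; lra.
have [_ b1] := RInt_inv_ln_bounds 2 y ltac:(lra) y2.
have [_ b2] := RInt_inv_ln_bounds y x ltac:(lra) yx.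
have [b3 _] := RInt_inv_ln_bounds 2 x ltac:(lra) ltac:(lra).
have low : x - 2 <= Li x * ln x.
  have -> : x - 2 = (x - 2) / ln x * ln x by field; lra.
  by apply: Rmult_le_compat_r; [lra|exact: b3].
have u1 : RInt (fun t => / ln t) 2 y * ln x <= 2 * (e * x).
  have i2 : / ln 2 <= 2.
    by rewrite -[X in _ <= X]Rinv_inv; apply: Rinv_le_contravar; lra.
  have : (y - 2) / ln 2 <= 2 * y by rewrite /Rdiv; nra.
  move=> h; have : RInt (fun t => / ln t) 2 y * ln x <= 2 * y * ln x.
    by apply: Rmult_le_compat_r; lra.
  lra.
have u2 : RInt (fun t => / ln t) y x * ln x <= (1 + 2 * e) * x.
  have E : (x - y) / ln y * ln x = (x - y) / (1 - e).
    by rewrite ly; field; lra.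
  have : RInt (fun t => / ln t) y x * ln x <= (x - y) / (1 - e).
    by rewrite -E; apply: Rmult_le_compat_r; lra.
  move=> h; apply: Rle_trans h _; apply: (Rmult_le_reg_r (1 - e)); first lra.
  have -> : (x - y) / (1 - e) * (1 - e) = x - y by field; lra.
  nra.
have X : Li x * ln x / x * x = Li x * ln x by field; lra.
by split; apply: (Rmult_le_reg_r x); rewrite ?X; try lra; rewrite LiE; lra.
Qed.

Theorem theorem2p1 : asymp_equiv (fun x : R => INR (prime_pi x)) Li.
Proof.
rewrite /asymp_equiv.
apply: (is_lim_ext_loc (fun x => (INR (prime_pi x) * ln x / x) / (Li x * ln x / x))).
  exists 2 => x x2; have := Li_gt0 x x2.
  have : 0 < ln x by rewrite -ln_1; apply: ln_increasing; lra.
  by move=> h1 h2; field; repeat split; lra.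
have := is_lim_div _ _ _ _ _ is_lim_prime_pi is_lim_Li.
by rewrite /= Rinv_1 Rmult_1_r; apply => //; case; lra.
Qed.
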